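(* Define $M_1=5$ and $M_{j+1}=M_j+4j^2+7j+11$ for $j\ge1$; then $M_j\le 5j^3$ for all $j\geq 1$. There exists $b_0$ such that for every integer $b\ge b_0$, every integer $j$ with $1\le j\le b^{1/10}$, and every real $u$ such that $\delta=\alpha\sqrt b-u$ satisfies $j-1/2\le\delta\le j+1/2$, $$V(u,b)-\frac ub=\frac{\alpha}{b^{3/2}}\Big(2j(\delta-1/2)-j(j-1)+r\Big)\quad\text{for some real } r \text{ with } |r|\le M_j\,b^{-1/4}.$$
   Context: Let $X_1,X_2,\dots$ be i.i.d. with $P(X_i=1)=P(X_i=-1)=1/2$ and $S_k=\sum_{i=1}^k X_i$, $S_0=0$. For real $u$ and positive integer $b$, $V(u,b)=\sup_T E\left[\frac{u+S_T}{b+T}\right]$, the supremum over all a.s. finite stopping times $T$ (with values in $\{0,1,2,\dots\}$) of the walk. The constant $\alpha=0.83992\ldots$ is the unique real root of $\alpha=(1-\alpha^2)\int_0^\infty \exp(\lambda\alpha-\lambda^2/2)\,d\lambda$. *)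

(* Defs.v *)
From HB Require Import structures.
From mathcomp Require Import all_boot all_order all_algebra.
From mathcomp Require Import finmap.
From mathcomp Require Import all_classical all_reals all_analysis.

Set Implicit Arguments.
Unset Strict Implicit.
Unset Printing Implicit Defensive.

Import Order.TTheory GRing.Theory Num.Theory.
Import numFieldNormedType.Exports.

Local Open Scope classical_set_scope.
Local Open Scope ring_scope.

Section walk.
Context d (Omega : measurableType d) (R : realType) (P : probability Omega R).
Implicit Type X : nat -> {RV P >-> R}.

Definition mutually_independent X :=
  forall (J : {fset nat}) (B : nat -> set R), (forall i, measurable (B i)) ->
    P (\bigcap_(i in [set` J]) (X i @^-1` B i)) =
    (\prod_(i <- J) P (X i @^-1` B i))%E.

(* Indices are shifted by one: X i is the (i+1)-st step of the walk. *)
Definition iid_signs X :=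
  mutually_independent X /\
  forall i, P (X i @^-1` [set 1]) = (2^-1)%:E /\
            P (X i @^-1` [set -1]) = (2^-1)%:E.

Definition walk X (k : nat) (w : Omega) : R := \sum_(i < k) X i w.

(* The sigma-algebra generated by the first n steps. *)
Definition natural_filtration X (n : nat) : set (set Omega) :=
  <<s \bigcup_(i in `I_n) preimage_set_system setT (X i) measurable >>.

(* None encodes the value +oo of a random time. *)
Definition stopping_time X (T : Omega -> option nat) :=
  forall n, natural_filtration X n [set w | T w = Some n].

Definition as_finite (T : Omega -> option nat) :=
  {ae P, forall w, T w <> None}.

(* The value 0 on the event T = +oo is irrelevant for a.s. finite T. *)
Definition reward X (u : R) (b : nat) (T : Omega -> option nat) (w : Omega) : R :=
  if T w is Some n then (u + walk X n w) / (b%:R + n%:R) else 0.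

Definition V X (u : R) (b : nat) : \bar R :=
  ereal_sup [set ('E_P[reward X u b T])%E |
    T in [set T | stopping_time X T /\ as_finite T]].

End walk.

(* Any real root; existence and uniqueness of the root are not assumed here. *)
Definition is_alpha (R : realType) (alpha : R) :=
  alpha = (1 - alpha ^+ 2) *
    \int[lebesgue_measure]_(l in `[0, +oo[) expR (l * alpha - l ^+ 2 / 2).

(* The sequence starts at j = 1; M 0 is a junk value. *)
Fixpoint M (j : nat) : nat :=
  match j with
  | 0 => 0%N
  | 1 => 5%N
  | k.+1 => (M k + 4 * k ^ 2 + 7 * k + 11)%N
  end.

(* Main.v *)
(** Write [A f u b := (f (u + 1) (b + 1) + f (u - 1) (b + 1)) / 2]; the value solves
    [V = max (u / b, A V)].  Since [cosh l <= exp (l ^ 2 / 2)], the function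
    [W u b = (1 - alpha ^ 2) * int_0^oo exp (l * u - l ^ 2 * b / 2) dl] satisfies [A W <= W],
    with [W - A W = O (b ^ (- 5 / 2))] below the curve [u = alpha * sqrt b].  Hence [V <= W],
    and the equation of [alpha] makes [W - u / b] equal to
    [alpha * b ^ (- 3 / 2) * (delta ^ 2 + O (delta ^ 3 / sqrt b))].
    The difference [E = W - V] is thus a martingale, up to a small drift, as long as it is
    optimal to continue.  It is at most [9 / 4 * alpha * b ^ (- 3 / 2)] for [delta >= - 1 / 2],
    and where the walk started at [delta] first comes within distance 1/2 of the curve, at
    [s = delta - j], it is close to [alpha * b ^ (- 3 / 2) * s ^ 2].  The curve moves by
    [O (n / sqrt b)] in [n] steps; comparing [E] with explicit quadratic barriers on a strip of
    width [b ^ (1 / 4)] shows that [E = alpha * b ^ (- 3 / 2) * (s ^ 2 + O (j * b ^ (- 1 / 4)))].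
    It remains to note that [delta ^ 2 - s ^ 2 = 2 * j * (delta - 1 / 2) - j * (j - 1)]. *)

Require Import Defs.
From HB Require Import structures.
From mathcomp Require Import all_boot all_order all_algebra.
From mathcomp Require Import finmap.
From mathcomp Require Import all_classical all_reals all_analysis.
From mathcomp Require Import measurable_realfun.
From mathcomp Require Import ring lra.
Import Order.TTheory GRing.Theory Num.Theory.
Import numFieldNormedType.Exports.
Local Open Scope classical_set_scope.
Local Open Scope ring_scope.
Set Implicit Arguments.
Unset Strict Implicit.
Unset Printing Implicit Defensive.

(** * Integrals on the half line *)

Section half_line.
Context {R : realType}.
Notation mu := (@lebesgue_measure R).
Implicit Types f g : R -> R.

(** Stopping is known to be optimal on and above the curve ([vh_stop]); below it the exact stopping
    region is unknown. This makes the two halves asymmetric: the bound from above on the value must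
    allow for stopping anywhere in the strip, while the bound from below uses only that the value
    dominates its average and the immediate reward. The equation [V = max (u / b, A V)] offers no
    start for an induction, so the first half runs on a finite horizon, and the second runs
    backwards from a time of order [sqrt b], where the time term of the barrier alone exceeds the
    global bound. That global bound is an induction on the horizon whose poor start is carried along
    as a term that averages to itself and vanishes as the horizon grows. The width of the strip
    balances two costs at distance [j]: [j / width] for ignorance at the far edge and
    [j * width / sqrt b] for the parabola that absorbs drift and errors. The total error is
    [5 * j * b ^ (- 1 / 4)], and [j <= b ^ (1 / 10)] keeps the cubic term [j ^ 3 / sqrt b] of [W]
    below it. *)

Lemma is_derive_expN (x : R) : is_derive x 1 (fun y => - expR (- y)) (expR (- x)).
Proof.
have h : is_derive x 1 (expR \o -%R) (expR (- x) * (- 1)) by exact: is_derive1_comp.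
apply: (@is_derive_eq _ _ _ _ _ _ _ _ (@is_deriveN _ _ _ (expR \o -%R) x 1 _ h)).
by rewrite mulrN1 opprK.
Qed.

Lemma ge0_FTC2y f (F : R -> R) (l : R) :
  (forall x, 0 <= x -> 0 <= f x) -> continuous f ->
  (forall x : R, is_derive x 1 F (f x)) -> F x @[x --> +oo] --> l ->
  (\int[mu]_(x in `[0%R, +oo[) (f x)%:E = (l - F 0)%:E)%E.
Proof.
move=> f0 cf dF Fl.
rewrite (@ge0_continuous_FTC2y R f F 0 l) //.
- exact: continuous_subspaceT.
- apply: cvg_at_right_filter; apply: differentiable_continuous.
  by apply/derivable1_diffP; case: (dF 0).
- by move=> x _; rewrite derive1E; case: (dF x).
Qed.

Lemma integral_expRN : (\int[mu]_(x in `[0%R, +oo[) (expR (- x))%:E = 1)%E.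
Proof.
have -> : 1%E = (0 - - expR (- 0) : R)%:E by rewrite oppr0 expR0 sub0r opprK.
apply: (@ge0_FTC2y (fun x => expR (- x)) (fun x => - expR (- x)) 0 _ _ is_derive_expN).
- by move=> x _; exact: expR_ge0.
- by move=> x; apply: continuous_comp; [exact: opp_continuous|exact: continuous_expR].
- by rewrite -[X in _ --> X]oppr0; apply: cvgN; exact: cvgr_expR.
Qed.

Definition expdom f := exists C : R, forall l, 0 <= l -> `|f l| <= C * expR (- l).

Lemma expdomD f g : expdom f -> expdom g -> expdom (fun l => f l + g l).
Proof.
move=> [C hC] [D hD]; exists (C + D) => l l0; rewrite mulrDl.
by rewrite (le_trans (ler_normD _ _))// lerD ?hC ?hD.
Qed.

Lemma expdomZ (c : R) f : expdom f -> expdom (fun l => c * f l).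
Proof.
move=> [C hC]; exists (`|c| * C) => l l0; rewrite normrM -mulrA.
by rewrite ler_wpM2l ?hC.
Qed.

Lemma measurable_cont f : continuous f -> measurable_fun (`[0%R, +oo[ : set R) f.
Proof.
by move=> cf; apply: subspace_continuous_measurable_fun => //; exact: continuous_subspaceT.
Qed.

Lemma continuous_exprN : continuous (fun x : R => expR (- x)).
Proof. by move=> x; apply: continuous_comp; [exact: opp_continuous|exact: continuous_expR]. Qed.

Lemma integrable_expRN (C : R) :
  mu.-integrable `[0%R, +oo[ (EFin \o (fun l => C * expR (- l))).
Proof.
have -> : EFin \o (fun l => C * expR (- l)) =
   (fun l => C%:E * (EFin \o (fun l => expR (- l))) l)%E by [].
apply: integrableZl => //; apply/integrableP; split.
  by apply/measurable_EFinP; exact: measurable_cont continuous_exprN.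
under eq_integral do rewrite /= ger0_norm ?expR_ge0//.
by rewrite integral_expRN ltry.
Qed.

Lemma integrable_expdom f : continuous f -> expdom f ->
  mu.-integrable `[0%R, +oo[ (EFin \o f).
Proof.
move=> cf [C hC]; apply: (@le_integrable _ _ _ mu _ _ _ (EFin \o (fun l => C * expR (- l)))) => //.
- by apply/measurable_EFinP; exact: measurable_cont.
- move=> x /=; rewrite in_itv/= andbT => x0; rewrite lee_fin.
  by rewrite (le_trans (hC _ x0))// ler_norm.
- exact: integrable_expRN.
Qed.

(** Adding [C * expR (- x)] makes the integrand nonnegative, which reduces the claim to
    [ge0_FTC2y]. *)
Lemma FTC2y_expdom f (F : R -> R) (l : R) : continuous f -> expdom f ->
  (forall x : R, is_derive x 1 F (f x)) -> F x @[x --> +oo] --> l ->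
  \int[mu]_(x in `[0%R, +oo[) f x = l - F 0.
Proof.
move=> cf [C hC] dF Fl.
have iE := integrable_expRN C.
have If : mu.-integrable `[0%R, +oo[ (EFin \o f).
  by apply: integrable_expdom => //; exists C.
have E1 : \int[mu]_(x in `[0%R, +oo[) (C * expR (- x)) = C.
  rewrite RintegralZl//; last first.
    by have := integrable_expRN 1; congr (integrable _ _ _); apply/funext => x /=; rewrite mul1r.
  by rewrite /Rintegral integral_expRN mulr1.
have : \int[mu]_(x in `[0%R, +oo[) (f x + C * expR (- x)) = l - F 0 + C.
  have dG (x : R) : is_derive x 1 (fun x => F x + C * - expR (- x)) (f x + C * expR (- x)).
    have h := is_derive_expN x.
    exact: (@is_deriveD _ _ _ F (C *: (fun y => - expR (- y)))).
  rewrite /Rintegral (@ge0_FTC2y _ _ l _ _ dG) /=.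
  - by rewrite oppr0 expR0; ring.
  - move=> x x0; rewrite -lerBlDr sub0r lerNl (le_trans _ (hC _ x0))//.
    by rewrite -normrN ler_norm.
  - move=> x; apply: cvgD; first exact: cf.
    by apply: cvgM; [exact: cvg_cst|exact: continuous_exprN].
  - rewrite -[X in _ --> X]addr0; apply: cvgD => //.
    rewrite -[X in _ --> X](mulr0 C); apply: cvgM; first exact: cvg_cst.
    by rewrite -oppr0; apply: cvgN; exact: cvgr_expR.
by rewrite RintegralD//= E1 => /addIr.
Qed.

Lemma Rintegral_scale (c : R) f : 0 < c -> continuous f ->
  (forall x, 0 <= x -> 0 <= f x) ->
  \int[mu]_(x in `[0%R, +oo[) f x = \int[mu]_(x in `[0%R, +oo[) (f (c * x) * c).
Proof.
move=> c0 cf f0.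
have dF (x : R) : is_derive x 1 (fun y => c * y) c.
  apply: (@is_derive_eq _ _ _ _ _ _ _ _ (@is_deriveZ _ _ _ id c x 1 _ _)).
  by rewrite /GRing.scale/= mulr1.
have dE : derive1 (fun y : R => c * y) = cst c.
  by apply/funext => x; rewrite derive1E; case: (dF x).
have := @increasing_ge0_integration_by_substitutiony R (fun y => c * y) f 0.
rewrite mulr0 dE => h; rewrite /Rintegral h //.
- by move=> x y _ _; rewrite ltr_pM2l.
- by move=> x _; exact: cst_continuous.
- exact: is_cvg_cst.
- exact: is_cvg_cst.
- split; first by move=> x _; case: (dF x).
  apply: cvg_at_right_filter; apply: differentiable_continuous.
  by apply/derivable1_diffP; case: (dF 0).
- by apply: gt0_cvgMry => //; exact: cvg_id.
- exact: continuous_subspaceT.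
- by move=> x; rewrite in_itv/= andbT => /ltW/f0.
Qed.

End half_line.

(** * Syntactic differentiation *)

Section derivative_rules.
Context {R : realType}.
Implicit Types f g : R -> R.

(* A copy of [is_derive] that is not a type class, so that rules are applied syntactically. *)
Definition der f (x a : R) := is_derive x 1 f a.

Lemma der_eq f (x a b : R) : der f x a -> a = b -> der f x b.
Proof. by move=> + <-. Qed.

Lemma der_D f g (x a b : R) : der f x a -> der g x b ->
  der (fun y => f y + g y) x (a + b).
Proof. by move=> fa gb; exact: (@is_deriveD _ _ _ f g). Qed.

Lemma der_N f (x a : R) : der f x a ->
  der (fun y => - f y) x (- a).
Proof. by move=> fa; exact: (@is_deriveN _ _ _ f). Qed.

Lemma der_M f g (x a b : R) : der f x a -> der g x b ->
  der (fun y => f y * g y) x (f x * b + g x * a).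
Proof. by move=> fa gb; exact: (@is_deriveM _ _ f g). Qed.

Lemma der_X n f (x a : R) : der f x a ->
  der (fun y => f y ^+ n.+1) x (n.+1%:R * f x ^+ n * a).
Proof.
move=> fa; have -> : (fun y => f y ^+ n.+1) = f ^+ n.+1 by apply/funext => y; rewrite exprfctE.
by apply: (@is_derive_eq _ _ _ _ _ _ _ _ (@is_deriveX _ _ f n.+1 x 1 a fa)).
Qed.

Lemma der_exp f (x a : R) : der f x a ->
  der (fun y => expR (f y)) x (expR (f x) * a).
Proof. by move=> fa; exact: (@is_derive1_comp _ expR f). Qed.

Lemma der_c (c x : R) : der (fun=> c) x 0.
Proof. exact: is_derive_cst. Qed.

Lemma der_id (x : R) : der (fun y => y) x 1.
Proof. exact: is_derive_id. Qed.

Lemma ge0_derive_ge0 (f f' : R -> R) : (forall x : R, der f x (f' x)) ->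
  (forall x, 0 <= x -> 0 <= f' x) -> forall x, 0 <= x -> f 0 <= f x.
Proof.
move=> df f'0 x x0; rewrite -subr_ge0.
have [|c + ->] := @MVT_segment _ f f' 0 x x0 (fun y _ => df y).
- apply: continuous_subspaceT => y; apply: differentiable_continuous.
  by apply/derivable1_diffP; case: (df y).
- by rewrite in_itv/= => /andP[c0 _]; rewrite mulr_ge0 ?subr_ge0// f'0.
Qed.

End derivative_rules.

Ltac der_tac := first
  [ exact: der_id | exact: der_c
  | apply: der_X; der_tac
  | apply: der_N; der_tac
  | apply: der_D; der_tac
  | apply: der_M; der_tac
  | apply: der_exp; der_tac ].

Ltac der_eq_tac := apply: der_eq; [der_tac|rewrite /=; field].

(** * Taylor bounds for the exponential and the hyperbolic cosine *)

Section exp_bounds.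
Context {R : realType}.
Implicit Type x : R.

Lemma expR_ge_deg2 x : 0 <= x -> 1 + x + x ^+ 2 / 2 <= expR x.
Proof.
move=> x0; rewrite -subr_ge0.
pose f x := expR x - (1 + x + x ^+ 2 / 2) : R.
have -> : 0 = f 0 by rewrite /f expR0; ring.
apply: (@ge0_derive_ge0 _ f (fun x => expR x - (1 + x))) => //.
  by move=> y; rewrite /f; der_eq_tac.
by move=> y _; rewrite subr_ge0 expR_ge1Dx.
Qed.

Lemma expRN_le_deg2 x : 0 <= x -> expR (- x) <= 1 - x + x ^+ 2 / 2.
Proof.
move=> x0; rewrite -subr_ge0.
pose f x := (1 - x + x ^+ 2 / 2) - expR (- x) : R.
have -> : 0 = f 0 by rewrite /f oppr0 expR0; ring.
apply: (@ge0_derive_ge0 _ f (fun x => expR (- x) - (1 + - x))) => //.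
  by move=> y; rewrite /f; der_eq_tac.
by move=> y _; rewrite subr_ge0 expR_ge1Dx.
Qed.

Lemma expRN_ge_deg3 x : 0 <= x -> 1 - x + x ^+ 2 / 2 - x ^+ 3 / 6 <= expR (- x).
Proof.
move=> x0; rewrite -subr_ge0.
pose f x := expR (- x) - (1 - x + x ^+ 2 / 2 - x ^+ 3 / 6) : R.
have -> : 0 = f 0 by rewrite /f oppr0 expR0; ring.
apply: (@ge0_derive_ge0 _ f (fun x => (1 - x + x ^+ 2 / 2) - expR (- x))) => //.
  by move=> y; rewrite /f; der_eq_tac.
by move=> y y0; rewrite subr_ge0 expRN_le_deg2.
Qed.

Lemma expR_le_deg2 x : 0 <= x -> expR x <= 1 + x + x ^+ 2 / 2 + x ^+ 3 * expR x.
Proof.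
have e1 y : 0 <= y -> expR y <= 1 + y * expR y :> R.
  move=> y0; have := expR_ge1Dx (- y); rewrite -(ler_pM2l (expR_gt0 y)) expRxMexpNx_1; lra.
have e2 y : 0 <= y -> 0 <= 1 + y + y ^+ 2 * expR y - expR y :> R.
  move=> y0; pose f x := 1 + x + x ^+ 2 * expR x - expR x : R.
  have -> : 0 = f 0 by rewrite /f expR0; ring.
  apply: (@ge0_derive_ge0 _ f (fun x => 1 + (2 * x + x ^+ 2) * expR x - expR x)) => //.
    by move=> z; rewrite /f; der_eq_tac.
  move=> z z0; have := e1 _ z0; have : 0 <= (z + z ^+ 2) * expR z.
    by rewrite mulr_ge0 ?expR_ge0// addr_ge0 ?exprn_ge0.
  lra.
move=> x0; rewrite -subr_ge0.
pose f x := 1 + x + x ^+ 2 / 2 + x ^+ 3 * expR x - expR x : R.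
have -> : 0 = f 0 by rewrite /f expR0; ring.
apply: (@ge0_derive_ge0 _ f (fun x => 1 + x + (3 * x ^+ 2 + x ^+ 3) * expR x - expR x)) => //.
  by move=> z; rewrite /f; der_eq_tac.
move=> z z0; have := e2 _ z0; have : 0 <= (2 * z ^+ 2 + z ^+ 3) * expR z.
  by rewrite mulr_ge0 ?expR_ge0// addr_ge0 ?mulr_ge0 ?exprn_ge0.
lra.
Qed.

(** By [cosh x - 1 = 2 * sinh (x / 2) ^ 2] and [2 * sinh (x / 2) >= x]. *)
Lemma cosh_ge x : 0 <= x -> 1 + x ^+ 2 / 2 <= (expR x + expR (- x)) / 2.
Proof.
move=> x0; have y0 : 0 <= x / 2 by lra.
have h1 := expR_ge_deg2 y0; have h2 := expRN_le_deg2 y0.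
have h3 : x ^+ 2 <= (expR (x / 2) - expR (- (x / 2))) ^+ 2.
  by rewrite ler_sqr ?nnegrE; lra.
have e1 : expR x = expR (x / 2) ^+ 2 by rewrite -expRM_natl; congr expR; field.
have e2 : expR (- x) = expR (- (x / 2)) ^+ 2 by rewrite -expRM_natl; congr expR; field.
have e3 := expRxMexpNx_1 (x / 2).
rewrite e1 e2; move: h3; rewrite sqrrB e3; lra.
Qed.

(** The function [exp (- x ^ 2 / 2) * cosh x] decreases, its derivative having the sign of
    [sinh x - x * cosh x]; the latter is nonpositive by [p]. *)
Lemma cosh_le x : 0 <= x -> (expR x + expR (- x)) / 2 <= expR (x ^+ 2 / 2).
Proof.
have p y : 0 <= y -> 0 <= y * (expR y + expR (- y)) - (expR y - expR (- y)) :> R.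
  move=> y0; pose f x := x * (expR x + expR (- x)) - (expR x - expR (- x)) : R.
  have -> : 0 = f 0 by rewrite /f oppr0 expR0; ring.
  apply: (@ge0_derive_ge0 _ f (fun x => x * (expR x - expR (- x)))) => //.
    by move=> z; rewrite /f; der_eq_tac.
  by move=> z z0; rewrite mulr_ge0// subr_ge0 ler_expR; lra.
move=> x0.
pose f x := - (expR (- (x ^+ 2 / 2)) * (expR x + expR (- x))) : R.
have : f 0 <= f x.
  apply: (@ge0_derive_ge0 _ f (fun x => expR (- (x ^+ 2 / 2)) *
     (x * (expR x + expR (- x)) - (expR x - expR (- x))))) => //.
    by move=> z; rewrite /f; der_eq_tac.
  by move=> z z0; rewrite mulr_ge0 ?expR_ge0// p.
rewrite /f lerN2 oppr0 expr0n/= mul0r oppr0 expR0 mul1r => h.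
rewrite -(ler_pM2l (expR_gt0 (- (x ^+ 2 / 2)))) [X in _ <= X]mulrC expRxMexpNx_1.
lra.
Qed.

End exp_bounds.

(** * Moments of the Gaussian kernel on the half line *)

Section gaussian_moments.
Context {R : realType}.
Notation mu := (@lebesgue_measure R).
Implicit Types (f g : R -> R) (u v l : R).
Definition int0y f : R := \int[mu]_(x in `[0%R, +oo[) f x.

(** The exponential martingale of Brownian motion with parameter [l], at position [u] and time
    [v]. *)
Definition gk u v l := expR (l * u - l ^+ 2 * v / 2).

Lemma gk_gt0 u v l : 0 < gk u v l. Proof. exact: expR_gt0. Qed.

Lemma continuous_gk u v : continuous (gk u v).
Proof.
move=> l; apply: differentiable_continuous; apply/derivable1_diffP.
have [a []//] : exists a, der (gk u v) l a.
by eexists; rewrite /gk; der_tac.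
Qed.

Definition adm f := continuous f /\ expdom f.

Lemma admD f g : adm f -> adm g -> adm (fun l => f l + g l).
Proof.
move=> [cf df] [cg dg]; split; last exact: expdomD.
by move=> x; apply: cvgD; [exact: cf|exact: cg].
Qed.

Lemma admZ (c : R) f : adm f -> adm (fun l => c * f l).
Proof.
move=> [cf df]; split; last exact: expdomZ.
by move=> x; apply: cvgM; [exact: cvg_cst|exact: cf].
Qed.

Lemma adm_gkX k u v : 0 < v -> adm (fun l => l ^+ k * gk u v l).
Proof.
move=> v0; split.
  by move=> x; apply: cvgM; [exact: exprn_continuous|exact: continuous_gk].
(* After [l ^ k <= expR (k * l)] and division by [expR (- l)], the exponent is a quadratic
   polynomial in [l]; this is its maximum. *)
exists (expR ((u + k%:R + 1) ^+ 2 / (2 * v))) => l l0.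
rewrite ger0_norm ?mulr_ge0 ?exprn_ge0 ?expR_ge0//.
apply: (@le_trans _ _ (expR l ^+ k * gk u v l)).
  rewrite ler_wpM2r ?expR_ge0// lerXn2r ?nnegrE ?expR_ge0//.
  by have := expR_ge1Dx l; lra.
rewrite -expRM_natl -!expRD ler_expR -subr_ge0.
have -> : (u + k%:R + 1) ^+ 2 / (2 * v) - l - (k%:R * l + (l * u - l ^+ 2 * v / 2)) =
  (u + k%:R + 1 - l * v) ^+ 2 / (2 * v) by field; exact: lt0r_neq0.
by rewrite divr_ge0 ?sqr_ge0// mulr_ge0// ltW.
Qed.

Lemma adm_gk u v : 0 < v -> adm (gk u v).
Proof.
move=> /(adm_gkX 0 u); congr adm; apply/funext => l; by rewrite expr0 mul1r.
Qed.

Lemma adm_integrable f : adm f -> mu.-integrable `[0%R, +oo[ (EFin \o f).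
Proof. by case; exact: integrable_expdom. Qed.

Lemma int0y_le f g : adm f -> adm g -> (forall l, 0 <= l -> f l <= g l) -> int0y f <= int0y g.
Proof.
move=> af ag fg; apply: le_Rintegral => //; try exact: adm_integrable.
by move=> x /=; rewrite in_itv/= andbT; exact: fg.
Qed.

Lemma int0y_D f g : adm f -> adm g -> int0y (fun l => f l + g l) = int0y f + int0y g.
Proof. by move=> af ag; apply: RintegralD => //; exact: adm_integrable. Qed.

Lemma int0y_Z (c : R) f : adm f -> int0y (fun l => c * f l) = c * int0y f.
Proof. by move=> af; apply: RintegralZl => //; exact: adm_integrable. Qed.

Lemma int0y_ext f g : (forall l, 0 <= l -> f l = g l) -> int0y f = int0y g.
Proof.
by move=> fg; apply: eq_Rintegral => x; rewrite inE/= in_itv/= andbT; exact: fg.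
Qed.

Definition mom k u := int0y (fun l => l ^+ k * gk u 1 l).

Lemma cvg_gkX k u v : 0 < v -> l ^+ k * gk u v l @[l --> +oo] --> (0 : R).
Proof.
move=> v0; have [_ [C hC]] := adm_gkX k u v0.
apply: (@squeeze_cvgr _ _ _ _ (cst 0) (fun l => C * expR (- l))).
- near=> l; rewrite mulr_ge0 ?exprn_ge0 ?expR_ge0//=.
  by rewrite (le_trans (ler_norm _))// hC.
- exact: cvg_cst.
- by rewrite -[X in _ --> X](mulr0 C); apply: cvgM; [exact: cvg_cst|exact: cvgr_expR].
Unshelve. all: by end_near. Qed.

Lemma der_gk u l : der (gk u 1) l ((u - l) * gk u 1 l).
Proof. by rewrite /gk; der_eq_tac. Qed.

(** Integration of the derivative of [- gk u 1]; the term [1] is the boundary value at [0]. The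
    recursion [momSE] comes in the same way from [- l ^ k.+1 * gk u 1 l], which vanishes at both
    ends. *)
Lemma mom1E u : mom 1 u = u * mom 0 u + 1.
Proof.
have a1 := adm_gkX 1 u (@ltr01 R); have a0 := adm_gkX 0 u (@ltr01 R).
have [c d] := admD a1 (admZ (- u) a0).
have := @FTC2y_expdom _ _ (fun l => - gk u 1 l) 0 c d.
rewrite -/(int0y _) (int0y_D a1 (admZ (- u) a0)) (int0y_Z (- u) a0) -!/(mom _ _) => h.
have g0 : gk u 1 0 = 1 by rewrite /gk mul0r expr0n/= !mul0r subrr expR0.
move: h; rewrite g0 => h.
have : mom 1 u + - u * mom 0 u = 0 - - 1; last by lra.
apply: h.
- by move=> x; apply: der_eq; [apply: der_N; exact: der_gk|rewrite expr0 expr1; ring].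
- rewrite -oppr0; apply: cvgN; have := cvg_gkX 0 u (@ltr01 R).
  by under eq_fun do rewrite expr0 mul1r.
Qed.

Lemma momSE k u : mom k.+2 u = u * mom k.+1 u + k.+1%:R * mom k u.
Proof.
have a2 := adm_gkX k.+2 u (@ltr01 R); have a1 := adm_gkX k.+1 u (@ltr01 R).
have a0 := adm_gkX k u (@ltr01 R).
have a3 := admD (admZ (- u) a1) (admZ (- k.+1%:R) a0).
have [c d] := admD a2 a3.
have := @FTC2y_expdom _ _ (fun l => - (l ^+ k.+1 * gk u 1 l)) 0 c d.
rewrite -/(int0y _) (int0y_D a2 a3) (int0y_D (admZ (- u) a1) (admZ (- k.+1%:R) a0)).
rewrite (int0y_Z (- u) a1) (int0y_Z (- k.+1%:R) a0) -!/(mom _ _) expr0n/= mul0r => h.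
have : mom k.+2 u + (- u * mom k.+1 u + - k.+1%:R * mom k u) = 0 - - 0; last by lra.
apply: h.
- move=> x; apply: der_eq; first by apply: der_N; apply: der_M; [der_tac|exact: der_gk].
  by rewrite !exprS; ring.
- by rewrite -oppr0; apply: cvgN; exact: cvg_gkX.
Qed.

End gaussian_moments.

(** * The Brownian value function *)

Section value_bound.
Context {R : realType}.
Variable al : R.
Hypothesis Hal : is_alpha al.
Implicit Types (f g : R -> R) (u v l t d y : R).
Let c : R := 1 - al ^+ 2.

(** [cmom0] is the equation of [al]. Together with [cmom1] it says that [W] and its derivative in
    [u] agree with those of [u / b] on the curve (smooth fit); [cmom2] provides the coefficient of
    the quadratic term. *)
Lemma cmom0 : c * mom 0 al = al.
Proof.
rewrite [RHS]Hal /c /mom; congr (_ * _); apply: int0y_ext => l _.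
by rewrite expr0 mul1r /gk mulr1.
Qed.

Lemma cmom1 : c * mom 1 al = 1.
Proof. by rewrite mom1E mulrDr mulrCA cmom0 /c; ring. Qed.

Lemma cmom2 : c * mom 2 al = 2 * al.
Proof. by rewrite momSE mulrDr !(mulrCA c) cmom1 cmom0; ring. Qed.

Lemma cmom3 : c * mom 3 al = 2 * al ^+ 2 + 2.
Proof. by rewrite momSE mulrDr !(mulrCA c) cmom2 cmom1; ring. Qed.

Lemma cmom4 : c * mom 4 al = 2 * al ^+ 3 + 8 * al.
Proof. by rewrite momSE mulrDr !(mulrCA c) cmom3 cmom2; ring. Qed.

Lemma mom_ge0 k u : 0 <= mom k u :> R.
Proof.
apply: Rintegral_ge0 => l /=; rewrite in_itv/= andbT => l0.
by rewrite mulr_ge0 ?exprn_ge0 ?expR_ge0.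
Qed.

(** The identity [c * mom 1 al = 1] with [mom 1 al >= 0] leaves no other sign. *)
Lemma c_gt0 : 0 < c.
Proof.
rewrite ltNge; apply/negP => c0; have := cmom1; have := mom_ge0 1 al.
nra.
Qed.

Let adX k u : adm (fun l => l ^+ k * gk u 1 l). Proof. exact: adm_gkX. Qed.

Lemma al_gt0 : 0 < al.
Proof.
have al0 : 0 <= al by rewrite -cmom0 mulr_ge0 ?mom_ge0// ltW// c_gt0.
(* Strict positivity comes from [l <= (1 + l ^ 2) / 2], which integrates to [1 <= 3 / 2 * al]. *)
have h : mom 1 al <= (1/2) * mom 0 al + (1/2) * mom 2 al.
  rewrite /mom -!int0y_Z// -int0y_D; [|exact: admZ..].
  apply: int0y_le => //; first by apply: admD; exact: admZ.
  move=> l l0; rewrite -subr_ge0.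
  have -> : 1 / 2 * (l ^+ 0 * gk al 1 l) + 1 / 2 * (l ^+ 2 * gk al 1 l) - l ^+ 1 * gk al 1 l
    = ((l - 1) ^+ 2 / 2) * gk al 1 l by field.
  by rewrite mulr_ge0 ?expR_ge0// divr_ge0 ?sqr_ge0.
have := c_gt0; have := cmom0; have := cmom1; have := cmom2; nra.
Qed.

Lemma al_lt1 : al < 1.
Proof. have := c_gt0; have := al_gt0; rewrite /c; nra. Qed.

Definition W u v := c * int0y (gk u v).

(** Averaging over one step multiplies the kernel by [exp (- l ^ 2 / 2) * cosh l], whatever [u] and
    [v]. An upper bound for this factor gives [W_super], a lower bound gives [W_defect]. *)
Lemma gk_step u v l : gk (u + 1) (v + 1) l + gk (u - 1) (v + 1) l =
  gk u v l * (expR (- (l ^+ 2 / 2)) * (expR l + expR (- l))).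
Proof.
by rewrite !mulrDr /gk -!expRD; congr (expR _ + expR _); field.
Qed.

Lemma W_step u v : 0 < v -> (W (u + 1) (v + 1) + W (u - 1) (v + 1)) / 2 =
  c * int0y (fun l => (1 / 2) * (gk (u + 1) (v + 1) l + gk (u - 1) (v + 1) l)).
Proof.
move=> v0; have a1 := adm_gk (u + 1) (addr_gt0 v0 ltr01).
have a2 := adm_gk (u - 1) (addr_gt0 v0 ltr01).
rewrite /W [X in _ = c * X](int0y_Z (1 / 2) (admD a1 a2)) (int0y_D a1 a2).
by move: (int0y _) (int0y _) => i1 i2; field.
Qed.

Lemma W_super u v : 0 < v -> (W (u + 1) (v + 1) + W (u - 1) (v + 1)) / 2 <= W u v.
Proof.
move=> v0; rewrite W_step// /W ler_pM2l ?c_gt0//.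
have a1 := adm_gk (u + 1) (addr_gt0 v0 ltr01).
have a2 := adm_gk (u - 1) (addr_gt0 v0 ltr01).
apply: int0y_le; [exact: admZ (admD a1 a2)|exact: adm_gk|].
move=> l l0; rewrite gk_step; have := cosh_le l0 => h.
rewrite mulrCA -[X in _ <= X]mulr1 ler_pM2l ?gk_gt0//.
rewrite expRN mulrCA ler_pdivrMl ?expR_gt0// mulr1; lra.
Qed.

(** The factor of [gk_step] is at least [1 - l ^ 4 / 4], so the defect is at most [c / 4] times a
    fourth moment. Raising [u] to [al * y] and rescaling [l] by [y] turns this moment into
    [mom 4 al / y ^ 5], and [c * mom 4 al = 2 * al ^ 3 + 8 * al <= 10 * al]. *)
Lemma W_defect u y : 0 < y -> u <= al * y ->
  W u (y ^+ 2) - (W (u + 1) (y ^+ 2 + 1) + W (u - 1) (y ^+ 2 + 1)) / 2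
    <= 5 / 2 * al / y ^+ 5.
Proof.
move=> y0 uy; have v0 : 0 < y ^+ 2 by rewrite exprn_gt0.
have a1 := adm_gk (u + 1) (addr_gt0 v0 ltr01).
have a2 := adm_gk (u - 1) (addr_gt0 v0 ltr01).
have a4 := adm_gkX 4 (al * y) v0.
have a0 := adm_gk u v0.
have e : int0y (gk u (y ^+ 2)) <=
   int0y (fun l => (1 / 2) * (gk (u + 1) (y ^+ 2 + 1) l + gk (u - 1) (y ^+ 2 + 1) l)) +
   (1 / 4) * int0y (fun l => l ^+ 4 * gk (al * y) (y ^+ 2) l).
  have a5 := admZ (1 / 2) (admD a1 a2).
  rewrite -int0y_Z// -int0y_D//; last exact: admZ.
  apply: int0y_le => //; first by apply: admD => //; exact: admZ.
  move=> l l0; rewrite gk_step.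
  have g1 : gk u (y ^+ 2) l <= gk (al * y) (y ^+ 2) l.
    by rewrite ler_expR lerB// ler_wpM2l.
  have : 1 - l ^+ 4 / 4 <= expR (- (l ^+ 2 / 2)) * ((expR l + expR (- l)) / 2).
    have h1 := cosh_ge l0; have h2 := expR_ge1Dx (- (l ^+ 2 / 2)).
    have l2 : 0 <= l ^+ 2 by rewrite exprn_ge0.
    have [l1|l1] := leP (l ^+ 2 / 2) 1.
      apply: (@le_trans _ _ ((1 - l ^+ 2 / 2) * (1 + l ^+ 2 / 2))).
        by rewrite (_ : l ^+ 4 = (l ^+ 2) ^+ 2) -?exprM//; nra.
      by apply: ler_pM => //; lra.
    apply: (@le_trans _ _ 0).
      by rewrite (_ : l ^+ 4 = (l ^+ 2) ^+ 2) -?exprM//; nra.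
    by rewrite mulr_ge0 ?expR_ge0// divr_ge0// addr_ge0 ?expR_ge0.
  have l4 : 0 <= l ^+ 4 by rewrite exprn_ge0.
  have := gk_gt0 u (y ^+ 2) l.
  move: (gk u (y ^+ 2) l) (gk (al * y) (y ^+ 2) l) g1 => g g' g1 g0.
  move: (expR (- (l ^+ 2 / 2))) (expR l) (expR (- l)) (l ^+ 4) l4 => e1 e2 e3 l4 l40 h.
  have : l4 * g <= l4 * g' by rewrite ler_wpM2l.
  have : g * (1 - l4 / 4) <= g * (e1 * ((e2 + e3) / 2)) by rewrite ler_wpM2l// ltW.
  lra.
have s : int0y (fun l => l ^+ 4 * gk (al * y) (y ^+ 2) l) = y ^- 5 * mom 4 al.
  have yi : 0 < y^-1 by rewrite invr_gt0.
  rewrite {1}/int0y (Rintegral_scale yi); last 2 first.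
  - by case: a4.
  - by move=> x x0; rewrite mulr_ge0 ?exprn_ge0 ?expR_ge0.
  rewrite /mom -int0y_Z//; apply: int0y_ext => l _.
  have -> : gk (al * y) (y ^+ 2) (y^-1 * l) = gk al 1 l.
    by rewrite /gk; congr expR; field; exact: lt0r_neq0.
  by field; exact: lt0r_neq0.
rewrite W_step// /W -mulrBr.
have c4 := cmom4.
have y5 : 0 < y ^- 5 by rewrite invr_gt0 exprn_gt0.
apply: (@le_trans _ _ (c * ((1 / 4) * (y ^- 5 * mom 4 al)))).
  rewrite (ler_pM2l c_gt0) -s; move: e; clear.
  by move: (int0y _) (int0y _) (int0y _) => i1 i2 i3; lra.
have -> : c * (1 / 4 * (y ^- 5 * mom 4 al)) = y ^- 5 * ((c * mom 4 al) / 4) by ring.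
rewrite c4 mulrC ler_pM2r//.
have := al_gt0; have := al_lt1 => h1 h0.
have : al ^+ 3 <= al by rewrite exprS ger_pMr// exprn_ile1 ?ltW.
lra.
Qed.

(** [W] at time [1] and distance [t] below the curve; by Brownian scaling ([W_G]) it determines [W]
    at all times. *)
Definition G t := c * int0y (gk (al - t) 1).

Lemma W_G d y : 0 < y -> W (al * y - d) (y ^+ 2) = G (d / y) / y.
Proof.
move=> y0; have yi : 0 < y^-1 by rewrite invr_gt0.
have v0 : 0 < y ^+ 2 by rewrite exprn_gt0.
have [a1 _] := adm_gk (al * y - d) v0.
rewrite /W {1}/int0y (Rintegral_scale yi) //; last by move=> x _; exact: expR_ge0.
rewrite /G -mulrA [_ / y]mulrC; congr (_ * _); rewrite -int0y_Z; last exact: adm_gk.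
 apply: int0y_ext => l _; rewrite mulrC; congr (_ * _).
by rewrite /gk; congr expR; field; exact: lt0r_neq0.
Qed.

Lemma gkB t l : gk (al - t) 1 l = gk al 1 l * expR (- (l * t)).
Proof. by rewrite /gk -expRD; congr expR; ring. Qed.

Let P t l := l ^+ 0 * gk al 1 l + (- t * (l ^+ 1 * gk al 1 l) + t ^+ 2 / 2 * (l ^+ 2 * gk al 1 l)).

Let admP t : adm (P t).
Proof. by rewrite /P; apply: admD => //; apply: admD; exact: admZ. Qed.

Let PE t l : P t l = gk al 1 l * (1 - l * t + (l * t) ^+ 2 / 2).
Proof. by rewrite /P; field. Qed.

Let IP t : c * int0y (P t) = al - t + al * t ^+ 2.
Proof.
have a0 := adX 0 al; have a1 := admZ (- t) (adX 1 al); have a2 := admZ (t ^+ 2 / 2) (adX 2 al).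
rewrite (int0y_D a0 (admD a1 a2)) (int0y_D a1 a2).
rewrite (int0y_Z (- t) (adX 1 al)) (int0y_Z (t ^+ 2 / 2) (adX 2 al)) -!/(mom _ _).
by rewrite 2!mulrDr cmom0 !(mulrCA c) cmom1 cmom2; field.
Qed.

Lemma G_le t : 0 <= t -> G t <= al - t + al * t ^+ 2.
Proof.
move=> t0; rewrite -IP /G ler_pM2l ?c_gt0//; apply: int0y_le; [exact: adm_gk|exact: admP|].
move=> l l0; rewrite PE gkB ler_pM2l ?gk_gt0//.
by apply: expRN_le_deg2; rewrite mulr_ge0.
Qed.

Lemma G_ge t : 0 <= t -> al - t + al * t ^+ 2 - t ^+ 3 <= G t.
Proof.
move=> t0; rewrite -IP.
have : c * int0y (P t) + c * ((- (t ^+ 3 / 6)) * mom 3 al) <= G t.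
  rewrite -mulrDr /mom -int0y_Z// -int0y_D//; last exact: admZ.
  rewrite /G ler_pM2l ?c_gt0//; apply: int0y_le; [by apply: admD => //; exact: admZ|exact: adm_gk|].
  move=> l l0; rewrite PE gkB.
  have := expRN_ge_deg3 (mulr_ge0 l0 t0).
  rewrite -(ler_pM2l (gk_gt0 al 1 l)); apply: le_trans.
  by rewrite le_eqVlt; apply/orP; left; apply/eqP; field.
rewrite mulrCA cmom3.
have h0 := al_gt0; have h1 := al_lt1.
have t3 : 0 <= t ^+ 3 by rewrite exprn_ge0.
have : t ^+ 3 * al ^+ 2 <= t ^+ 3 by rewrite ler_piMr// exprn_ile1// ltW.
lra.
Qed.

Lemma G_ge_neg t : t <= 0 -> al - t + al * t ^+ 2 <= G t.
Proof.
move=> t0; rewrite -IP /G ler_pM2l ?c_gt0//; apply: int0y_le; [exact: admP|exact: adm_gk|].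
move=> l l0; rewrite PE gkB ler_pM2l ?gk_gt0//.
have lt0 : 0 <= - (l * t) by rewrite oppr_ge0 mulr_ge0_le0.
by have := expR_ge_deg2 lt0; rewrite sqrrN.
Qed.

Lemma G_le_neg : exists2 K, 0 <= K & forall t, -1 <= t -> t <= 0 ->
  G t <= al - t + al * t ^+ 2 + K * (- t) ^+ 3.
Proof.
(* For [-1 <= t <= 0] the factor [expR (- (l * t))] of the cubic remainder is at most [expR l],
   which shifts the kernel from [al] to [al + 1]. *)
exists (c * mom 3 (al + 1)); first by rewrite mulr_ge0 ?mom_ge0 ?ltW ?c_gt0.
move=> t t1 t0; rewrite -IP -mulrA -mulrDr [mom _ _ * _]mulrC /mom -int0y_Z// -int0y_D//; last exact: admZ.
rewrite /G ler_pM2l ?c_gt0//; apply: int0y_le; [exact: adm_gk|by apply: admD => //; exact: admZ|].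
move=> l l0; rewrite PE gkB.
have lt0 : 0 <= - (l * t) by rewrite oppr_ge0 mulr_ge0_le0.
have := expR_le_deg2 lt0; rewrite -(ler_pM2l (gk_gt0 al 1 l)) => /le_trans; apply.
rewrite sqrrN mulrDr lerD2l.
have -> : gk (al + 1) 1 l = gk al 1 l * expR l by rewrite /gk -expRD; congr expR; ring.
have -> : (- t) ^+ 3 * (l ^+ 3 * (gk al 1 l * expR l)) = gk al 1 l * ((- (l * t)) ^+ 3 * expR l) by ring.
rewrite ler_pM2l ?gk_gt0// ler_wpM2l ?exprn_ge0// ler_expR; nra.
Qed.

(** The slope of [G] at [t >= 0] is at least [- c * mom 1 al = -1]. *)
Lemma G_mono t1 t2 : 0 <= t1 -> t1 <= t2 -> G t1 + t1 <= G t2 + t2.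
Proof.
move=> t0 t12.
have : G t1 <= c * int0y (gk (al - t2) 1) + c * ((t2 - t1) * mom 1 al).
  rewrite -mulrDr /mom -int0y_Z// -int0y_D; [|exact: adm_gk|exact: admZ].
  rewrite /G ler_pM2l ?c_gt0//; apply: int0y_le; [exact: adm_gk|by apply: admD; [exact: adm_gk|exact: admZ]|].
  move=> l l0; rewrite !gkB.
  have -> : (t2 - t1) * (l ^+ 1 * gk al 1 l) = gk al 1 l * (l * (t2 - t1)) by ring.
  rewrite -mulrDr ler_pM2l ?gk_gt0//.
  have -> : expR (- (l * t2)) = expR (- (l * t1)) * expR (- (l * (t2 - t1))).
    by rewrite -expRD; congr expR; ring.
  have h := expR_ge1Dx (- (l * (t2 - t1))).
  have h1 : expR (- (l * t1)) <= 1 by rewrite expR_le1 oppr_le0 mulr_ge0.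
  have h2 := expR_ge0 (- (l * t1)).
  have h3 : 0 <= l * (t2 - t1) by rewrite mulr_ge0// subr_ge0.
  have := ler_wpM2l h2 h; nra.
rewrite mulrCA cmom1 /G; move: (c * int0y (gk (al - t1) 1)) (c * int0y _) => g1 g2.
lra.
Qed.

End value_bound.

(** * The excess of [W] over the immediate reward *)

Section excess.
Context {R : realType}.
Variable al : R.
Hypothesis Hal : is_alpha al.
Implicit Types (u d y t : R) (b k n : nat).

(** The right side is the tangent of [G] at [0]. This makes [W] a majorant of [u / b] above the
    curve too, where it is no longer the Brownian value. *)
Lemma G_tangent t : al - t <= G al t.
Proof.
have [t0|t0] := leP 0 t.
  have := G_mono Hal (lexx 0) t0; have := G_ge Hal (lexx 0).
  by rewrite !expr0n/= !(mulr0, subr0, addr0); move: (G al t) (G al 0) => g g0; lra.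
have := G_ge_neg Hal (ltW t0).
have : 0 <= al * t ^+ 2 by rewrite mulr_ge0 ?sqr_ge0// ltW// al_gt0.
lra.
Qed.

Lemma G_le_al t : 0 <= t -> G al t <= al.
Proof.
move=> t0; have := G_le Hal (lexx 0); rewrite expr0n/= mulr0 subr0 addr0.
apply: le_trans; rewrite /G ler_pM2l ?(c_gt0 Hal)//.
apply: int0y_le; [exact: adm_gk|exact: adm_gk|move=> l l0].
by rewrite ler_expR subr0 lerB// ler_wpM2l//; lra.
Qed.

(** [W - u / b] at distance [d] below the curve at time [y ^ 2]. *)
Definition excess d y := (G al (d / y) - al + d / y) / y.

Lemma W_excess u d y : 0 < y -> u = al * y - d -> W al u (y ^+ 2) = u / y ^+ 2 + excess d y.
Proof.
by move=> y0 ->; rewrite W_G// /excess; field; exact: lt0r_neq0.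
Qed.

Lemma excess_ge0 d y : 0 < y -> 0 <= excess d y.
Proof.
by move=> y0; apply: divr_ge0; [have := G_tangent (d / y); lra|exact: ltW].
Qed.

Lemma excess_le d y : 0 < y -> 0 <= d -> excess d y <= al * d ^+ 2 / y ^+ 3.
Proof.
move=> y0 d0; rewrite ler_pdivrMr//.
have -> : al * d ^+ 2 / y ^+ 3 * y = al * (d / y) ^+ 2 by field; exact: lt0r_neq0.
by have := G_le Hal (divr_ge0 d0 (ltW y0)); move: (d / y) => t; lra.
Qed.

Lemma excess_ge d y : 0 < y -> 0 <= d -> al * d ^+ 2 / y ^+ 3 - d ^+ 3 / y ^+ 4 <= excess d y.
Proof.
move=> y0 d0; rewrite ler_pdivlMr//.
have -> : (al * d ^+ 2 / y ^+ 3 - d ^+ 3 / y ^+ 4) * y = al * (d / y) ^+ 2 - (d / y) ^+ 3.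
  by field; exact: lt0r_neq0.
by have := G_ge Hal (divr_ge0 d0 (ltW y0)); move: (d / y) => t; lra.
Qed.

Lemma excess_ge_neg d y : 0 < y -> d <= 0 -> al * d ^+ 2 / y ^+ 3 <= excess d y.
Proof.
move=> y0 d0; rewrite ler_pdivlMr//.
have -> : al * d ^+ 2 / y ^+ 3 * y = al * (d / y) ^+ 2 by field; exact: lt0r_neq0.
have d1 : d / y <= 0 by rewrite pmulr_lle0// invr_gt0.
by have := G_ge_neg Hal d1; move: (d / y) => t; lra.
Qed.

Lemma excess_le_neg : exists2 K, 0 <= K & forall d y, 1 <= y -> - y <= d -> d <= 0 ->
  excess d y <= al * d ^+ 2 / y ^+ 3 + K * (- d) ^+ 3 / y ^+ 4.
Proof.
have [K K0 hK] := G_le_neg Hal; exists K => // d y y1 dy d0.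
have y0 : 0 < y by lra.
rewrite ler_pdivrMr//.
have -> : (al * d ^+ 2 / y ^+ 3 + K * (- d) ^+ 3 / y ^+ 4) * y = al * (d / y) ^+ 2 + K * (- (d / y)) ^+ 3.
  by field; exact: lt0r_neq0.
have d1 : d / y <= 0 by rewrite pmulr_lle0// invr_gt0.
have d2 : -1 <= d / y by rewrite ler_pdivlMr// mulN1r.
by have := hK _ d2 d1; move: (d / y) => t; lra.
Qed.

Lemma excess_mono d1 d2 y : 0 < y -> 0 <= d1 -> d1 <= d2 -> excess d1 y <= excess d2 y.
Proof.
move=> y0 d0 d12; rewrite ler_pM2r ?invr_gt0//.
have h : d1 / y <= d2 / y by rewrite ler_pM2r ?invr_gt0.
have := G_mono Hal (divr_ge0 d0 (ltW y0)) h; move: (d1 / y) (d2 / y) => t1 t2.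
by move: (G al t1) (G al t2) => g1 g2; clear; lra.
Qed.

(** A bound for points far from the curve, where [d] may be of order [y] or larger and the quadratic
    one is too weak. *)
Lemma excess_lin d y : 0 < y -> 0 <= d -> excess d y <= d / y ^+ 2.
Proof.
move=> y0 d0; rewrite ler_pdivrMr//.
have -> : d / y ^+ 2 * y = d / y by field; exact: lt0r_neq0.
by have := G_le_al (divr_ge0 d0 (ltW y0)); move: (d / y) => t; lra.
Qed.

End excess.

(** * Finite-horizon values *)

Section horizon.
Context {R : realType}.
Implicit Types (u d y t : R) (b k n : nat).

Fixpoint vh k u b : R :=
  if k is k'.+1 then Num.max (u / b%:R) ((vh k' (u + 1) b.+1 + vh k' (u - 1) b.+1) / 2)
  else u / b%:R.

(** The value when any deterministic horizon may be chosen; [V_gval] identifies it with the value of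
    the game. *)
Definition gval u b : R := sup (range (fun k => vh k u b)).

Lemma vh_ge k u b : u / b%:R <= vh k u b.
Proof. by case: k => [|k]//=; rewrite le_max lexx. Qed.

Lemma vhS_ge k u b : (vh k (u + 1) b.+1 + vh k (u - 1) b.+1) / 2 <= vh k.+1 u b.
Proof. by rewrite /= le_max lexx orbT. Qed.

Lemma vh_monoS k u b : vh k u b <= vh k.+1 u b.
Proof.
elim: k u b => [|k IH] u b; first by rewrite /= le_max lexx.
rewrite [X in X <= _]/= ge_max vh_ge andTb.
by apply: le_trans (vhS_ge k.+1 u b); rewrite ler_pM2r// lerD.
Qed.

Lemma vh_mono u b : nondecreasing_seq (fun k => vh k u b).
Proof. by apply/nondecreasing_seqP => k; exact: vh_monoS. Qed.

(** Raising the start by [u - u0] raises the reward after [n] steps by [(u - u0) / (b + n)], which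
    is largest at [n = 0]. *)
Lemma vh_shift k u u0 b : (0 < b)%N -> u0 <= u ->
  vh k u b <= vh k u0 b + (u - u0) / b%:R.
Proof.
elim: k u u0 b => [|k IH] u u0 b b0 uu0; first by rewrite /= mulrBl; lra.
have h : u / b%:R <= vh k.+1 u0 b + (u - u0) / b%:R.
  by have := vh_ge k.+1 u0 b; rewrite mulrBl; lra.
rewrite [X in X <= _]/= ge_max h andTb.
have h1 : u0 + 1 <= u + 1 by rewrite lerD2r.
have h2 : u0 - 1 <= u - 1 by rewrite lerD2r.
have := IH _ _ b.+1 isT h1; have := IH _ _ b.+1 isT h2.
have e : (u - u0) / b.+1%:R <= (u - u0) / b%:R.
  by rewrite ler_wpM2l ?subr_ge0// lef_pV2 ?posrE ?ltr0n// ler_nat.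
have -> : u + 1 - (u0 + 1) = u - u0 by ring.
have -> : u - 1 - (u0 - 1) = u - u0 by ring.
have := vhS_ge k u0 b; move: e; set r := _ / b.+1%:R; set r' := _ / b%:R; lra.
Qed.

End horizon.

Section bounds.
Context {R : realType}.
Variable al : R.
Hypothesis Hal : is_alpha al.
Implicit Types (u d y t : R) (b k n : nat).

Let sq (b : nat) : R := Num.sqrt b%:R.

Lemma sqE b : sq b ^+ 2 = b%:R. Proof. by rewrite sqr_sqrtr. Qed.
Lemma sq_gt0 b : (0 < b)%N -> 0 < sq b.
Proof. by move=> b0; rewrite sqrtr_gt0 ltr0n. Qed.

Lemma W_sq u b : (0 < b)%N -> W al u b%:R = u / b%:R + excess al (al * sq b - u) (sq b).
Proof.
by move=> b0; rewrite -sqE; apply: W_excess; [exact: sq_gt0|ring].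
Qed.

Lemma vh_le_W k u b : (0 < b)%N -> vh k u b <= W al u b%:R.
Proof.
elim: k u b => [|k IH] u b b0.
  by rewrite /= W_sq// lerDl excess_ge0// sq_gt0.
rewrite /= ge_max W_sq// lerDl (excess_ge0 Hal) ?sq_gt0//= -W_sq//.
apply: le_trans (W_super Hal u _); last by rewrite ltr0n.
by rewrite -natr1 ler_pM2r// lerD// natr1 IH.
Qed.

(** On the curve the excess is zero, so [vh <= W] is an equality with the reward; [vh_shift] carries
    this upwards. Above the curve [W] itself does not suffice, since it may exceed the reward. *)
Lemma vh_stop k u b : (0 < b)%N -> al * sq b <= u -> vh k u b = u / b%:R.
Proof.
move=> b0 h; apply/eqP; rewrite eq_le vh_ge andbT.
apply: le_trans (vh_shift k b0 h) _.
have := vh_le_W k (al * sq b) b0; rewrite W_sq// subrr.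
have : excess al 0 (sq b) <= 0.
  have := excess_le Hal (sq_gt0 b0) (lexx 0).
  by rewrite expr0n/= mulr0 mul0r.
by rewrite mulrBl; lra.
Qed.

Lemma sq_step b : sq b.+1 ^+ 2 = sq b ^+ 2 + 1.
Proof. by rewrite !sqE natr1. Qed.

Lemma vh_defect k u b : (0 < b)%N -> u <= al * sq b ->
  W al u b%:R - vh k.+1 u b <= 5 / 2 * al / sq b ^+ 5 +
  ((W al (u + 1) b.+1%:R - vh k (u + 1) b.+1) + (W al (u - 1) b.+1%:R - vh k (u - 1) b.+1)) / 2.
Proof.
move=> b0 h; have := W_defect Hal (sq_gt0 b0) h; rewrite sqE natr1.
have := vhS_ge k u b; move: (vh k.+1 u b) => v; clear.
move: (W _ _ _) (W _ _ _) (W _ _ _) => w1 w2 w3; lra.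
Qed.

Lemma sq_mono b b' : (b <= b')%N -> sq b <= sq b'.
Proof. by move=> h; rewrite ler_sqrt// ler_nat. Qed.

(** In one step [(9 / 4) / y ^ 3] drops by about [(27 / 8) / y ^ 5], enough to pay for the defect
    [(5 / 2) / y ^ 5] of [W]. The proof uses [sqrt (y ^ 2 + 1) >= y + (9 / 20) / y]. *)
Lemma inv_cube_step y z : 5 <= y ^+ 2 -> 0 < y -> 0 < z -> z ^+ 2 = y ^+ 2 + 1 ->
  (9 / 4) / z ^+ 3 + (5 / 2) / y ^+ 5 <= (9 / 4) / y ^+ 3.
Proof.
move=> y5 y0 z0 zy.
have z1 : y + 9 / 20 / y <= z.
  have yi0 : 0 <= y + 9 / 20 / y by rewrite ltW// addr_gt0// divr_gt0.
  rewrite -ler_sqr ?nnegrE ?(ltW z0)// zy.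
  have -> : (y + 9 / 20 / y) ^+ 2 = y ^+ 2 + 9 / 10 + 81 / 400 / y ^+ 2.
    by field; exact: lt0r_neq0.
  have : 81 / 400 / y ^+ 2 <= 1 / 10 by rewrite ler_pdivrMr ?exprn_gt0//; lra.
  lra.
have z3 : y ^+ 3 + 29 / 20 * y <= z ^+ 3.
  rewrite [z ^+ 3]exprS zy.
  apply: (@le_trans _ _ ((y + 9 / 20 / y) * (y ^+ 2 + 1))); last first.
    by rewrite ler_pM2r// addr_gt0 ?exprn_gt0.
  have -> : (y + 9 / 20 / y) * (y ^+ 2 + 1) = y ^+ 3 + 29 / 20 * y + 9 / 20 / y.
    by field; exact: lt0r_neq0.
  by rewrite lerDl divr_ge0// ltW.
have y3 : 0 < y ^+ 3 by rewrite exprn_gt0.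
have y30 : 0 < y ^+ 3 + 29 / 20 * y by rewrite addr_gt0// mulr_gt0.
have : 9 / 4 / z ^+ 3 <= 9 / 4 / (y ^+ 3 + 29 / 20 * y).
  by rewrite ler_pM2l// lef_pV2 ?posrE ?exprn_gt0.
suff : 9 / 4 / (y ^+ 3 + 29 / 20 * y) <= 9 / 4 / y ^+ 3 - 5 / 2 / y ^+ 5.
  by set r1 := 9 / 4 / _; set r2 := 9 / 4 / _; set r3 := 9 / 4 / _; set r4 := 5 / 2 / _; lra.
rewrite ler_pdivrMr//.
have -> : (9 / 4 / y ^+ 3 - 5 / 2 / y ^+ 5) * (y ^+ 3 + 29 / 20 * y) =
   9 / 4 + (61 / 80 - 29 / 8 / y ^+ 2) / y ^+ 2 by field; exact: lt0r_neq0.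
rewrite lerDl divr_ge0 ?sqr_ge0// subr_ge0 ler_pdivrMr ?exprn_gt0//; lra.
Qed.

(* Satisfies [remainder k.+1 u b = (remainder k (u + 1) b.+1 + remainder k (u - 1) b.+1) / 2],
   because [u ^ 2 - b] averages to itself along the walk. *)
Definition remainder k u b : R :=
  let z := sq (b + k) in 1 / z + ((u ^+ 2 + k%:R) / z + z) / (2 * z ^+ 2).

Lemma remainderS k u b : remainder k.+1 u b =
  (remainder k (u + 1) b.+1 + remainder k (u - 1) b.+1) / 2.
Proof.
have z0 : sq (b + k).+1 != 0 by rewrite lt0r_neq0// sqrtr_gt0 ltr0n.
by rewrite /remainder addnS addSn -natr1; field.
Qed.

Lemma remainder_ge0 k u b : 0 <= remainder k u b.
Proof.
have z0 : 0 <= sq (b + k) by exact: sqrtr_ge0.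
by rewrite addr_ge0 ?divr_ge0// ?mulr_ge0 ?sqr_ge0// addr_ge0// divr_ge0// addr_ge0 ?sqr_ge0.
Qed.

End bounds.

(** * Global estimate of [W] minus the value *)

Section global_bound.
Context {R : realType}.
Variable al : R.
Hypothesis Hal : is_alpha al.
Implicit Types (u d y t : R) (b k n : nat).

Local Notation sq b := (Num.sqrt b%:R : R).

(** Stopping at once is good enough here: the quadratic part of the excess is at most
    [(1 / 4) * al / y ^ 3], and the choice of the threshold bounds the cubic part by
    [al / y ^ 3]. *)
Lemma vh_near : exists2 Y : R, 0 < Y & forall k u b, Y <= sq b ->
  al * sq b - 1 / 2 <= u -> u <= al * sq b + 1 / 2 ->
  W al u b%:R - vh k u b <= (9 / 4) * al / sq b ^+ 3.
Proof.
have a0 := al_gt0 Hal; have a1 := al_lt1 Hal.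
have [K K0 hK] := excess_le_neg Hal.
have K1 : 0 <= K / al := divr_ge0 K0 (ltW a0).
exists (3 + K / al) => [|k u b]; first lra.
set y := sq b => hY hd hu.
have y0 : 0 < y by lra.
have b0 : (0 < b)%N by move: y0; rewrite /y sqrtr_gt0 ltr0n.
have y3 : 0 < y ^+ 3 by rewrite exprn_gt0.
apply: (@le_trans _ _ (excess al (al * y - u) y)).
  by rewrite W_sq//; have := vh_ge k u b; rewrite -/y; lra.
have [d0|d0] := leP 0 (al * y - u).
  apply: le_trans (excess_le Hal y0 d0) _; rewrite ler_pM2r ?invr_gt0// mulrC ler_pM2r//; nra.
have dy : - y <= al * y - u by lra.
have y1 : 1 <= y by lra.
apply: le_trans (hK _ _ y1 dy (ltW d0)) _.
have h1 : (al * y - u) ^+ 2 <= 1 / 4 by nra.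
have h2 : (- (al * y - u)) ^+ 3 <= 1 by apply: exprn_ile1; lra.
have h3 : K <= al * y by rewrite mulrC -ler_pdivrMr//; lra.
have -> : al * (al * y - u) ^+ 2 / y ^+ 3 + K * (- (al * y - u)) ^+ 3 / y ^+ 4 =
    (al * (al * y - u) ^+ 2 + K * (- (al * y - u)) ^+ 3 / y) / y ^+ 3 by field; exact: lt0r_neq0.
rewrite ler_pM2r ?invr_gt0//.
have h4 : K * (- (al * y - u)) ^+ 3 / y <= al by rewrite ler_pdivrMr// (le_trans _ h3)// ler_piMr.
have : al * (al * y - u) ^+ 2 <= al * (1 / 4) by rewrite ler_wpM2l// ltW.
lra.
Qed.

(** At horizon [0] the difference is the whole excess, at most [d / y ^ 2]; with
    [- u <= (u ^ 2 / y + y) / 2] it is dominated by a quadratic in [u], whose expectation along the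
    walk is explicit. This is [remainder]. The term in [1 / y ^ 3] absorbs the defect of [W] at each
    step. *)
Lemma vh_global : exists2 Y : R, 0 < Y & forall k u b, Y <= sq b -> u <= al * sq b + 1 / 2 ->
  W al u b%:R - vh k u b <= (9 / 4) * al / sq b ^+ 3 + remainder k u b.
Proof.
have a0 := al_gt0 Hal; have a1 := al_lt1 Hal.
have [Y Y0 near_bound] := vh_near.
exists (Y + 3) => [|k u b]; first lra.
elim: k u b => [|k IH] u b; set y := sq b => hY hu.
all: have y0 : 0 < y by lra.
all: have b0 : (0 < b)%N by move: y0; rewrite /y sqrtr_gt0 ltr0n.
all: have hY1 : Y <= y by lra.
all: have [hd|hd] := leP (al * y - 1 / 2) u;
  first by apply: ler_wpDr; [exact: remainder_ge0|exact: near_bound].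
  have d0 : 0 <= al * y - u by lra.
  rewrite /= W_sq// addrAC subrr add0r -/y.
  apply: (@le_trans _ _ (remainder 0 u b)); last first.
    by rewrite ler_wpDl// divr_ge0 ?mulr_ge0 ?exprn_ge0 ?(ltW a0) ?(ltW y0).
  apply: le_trans (excess_lin Hal y0 d0) _.
  rewrite /remainder addn0 -/y addr0.
  have -> : 1 / y + (u ^+ 2 / y + y) / (2 * y ^+ 2) = (y + (u ^+ 2 + y ^+ 2) / (2 * y)) / y ^+ 2.
    by field; exact: lt0r_neq0.
  rewrite ler_pM2r ?invr_gt0 ?exprn_gt0//.
  have h1 : - u <= (u ^+ 2 + y ^+ 2) / (2 * y).
    by rewrite ler_pdivlMr ?mulr_gt0//; have := sqr_ge0 (u + y); nra.
  have : al * y <= y by nra.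
  lra.
have hY' : Y + 3 <= sq b.+1 by apply: le_trans hY _; exact: sq_mono.
have y1 : 0 < sq b.+1 by lra.
have yy : al * y <= al * sq b.+1 by rewrite ler_pM2l//; exact: sq_mono.
(* Here [u < al * y - 1 / 2], so a step up ends at most [1 / 2] above the curve; hence the [1 / 2]
   in the statement. *)
have h1 : u + 1 <= al * sq b.+1 + 1 / 2 by lra.
have h2 : u - 1 <= al * sq b.+1 + 1 / 2 by lra.
have := IH _ _ hY' h1; have := IH _ _ hY' h2.
have hu' : u <= al * sq b by rewrite -/y; lra.
have := vh_defect Hal k b0 hu'; rewrite remainderS -/y.
have y5 : 5 <= y ^+ 2 by nra.
have := @inv_cube_step _ y (sq b.+1) y5 y0 y1 (sq_step _).
rewrite -(ler_pM2l a0) mulrDr.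
have ac (x z : R) : x * al / z = al * (x / z) by ring.
rewrite !ac; move: (al * _) (al * _) (al * _) => e1 e2 e3; clear.
move: (W _ _ _) (W _ _ _) (W _ _ _) (vh k.+1 _ _) => w1 w2 w3 v3; lra.
Qed.
End global_bound.

(** * The infinite-horizon value *)

Section value.
Context {R : realType}.
Variable al : R.
Hypothesis Hal : is_alpha al.
Implicit Types (u d y t : R) (b k n : nat).

Local Notation sq b := (Num.sqrt b%:R : R).

Lemma gval_ge k u b : (0 < b)%N -> vh k u b <= gval u b.
Proof.
move=> b0; apply: ub_le_sup; last by exists k.
by exists (W al u b%:R) => _ [k' _ <-]; exact: vh_le_W.
Qed.

Lemma gval_le u b (c : R) : (forall k, vh k u b <= c) -> gval u b <= c.
Proof. by move=> h; apply: ge_sup; [exists (vh 0 u b); exists 0|move=> _ [k _ <-]]. Qed.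

Lemma gval_super u b : (0 < b)%N -> (gval (u + 1) b.+1 + gval (u - 1) b.+1) / 2 <= gval u b.
Proof.
move=> b0; suff : gval (u + 1) b.+1 <= 2 * gval u b - gval (u - 1) b.+1 by lra.
apply: gval_le => k1; suff : gval (u - 1) b.+1 <= 2 * gval u b - vh k1 (u + 1) b.+1 by lra.
apply: gval_le => k2.
have := gval_ge (maxn k1 k2).+1 u b0; have := vhS_ge (maxn k1 k2) u b.
have := vh_mono (u + 1) b.+1 (leq_maxl k1 k2); have := vh_mono (u - 1) b.+1 (leq_maxr k1 k2).
lra.
Qed.

Lemma remainder_small u b (e : R) : 0 < e -> exists k, remainder k u b <= e.
Proof.
move=> e0; exists (Num.bound (u ^+ 2 + (3 / e) ^+ 2)); set k := Num.bound _.
have hk : u ^+ 2 + (3 / e) ^+ 2 < k%:R by apply: archi_boundP; rewrite addr_ge0 ?sqr_ge0.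
rewrite /remainder; set z := sq _.
have e3 : 0 < 3 / e by rewrite divr_gt0.
have u2 : 0 <= u ^+ 2 by rewrite sqr_ge0.
have z2 : k%:R <= z ^+ 2 by rewrite sqr_sqrtr// natrD lerDr.
have ez : 3 / e <= z.
  rewrite -ler_sqr ?nnegrE ?sqrtr_ge0 ?(ltW e3)//; lra.
have z0 : 0 < z by apply: lt_le_trans ez.
apply: (@le_trans _ _ (3 / z)); last by rewrite ler_pdivrMr// mulrC -ler_pdivrMr.
have -> : 1 / z + ((u ^+ 2 + k%:R) / z + z) / (2 * z ^+ 2) =
   (3 / 2 + (u ^+ 2 + k%:R) / (2 * z ^+ 2)) / z by field; exact: lt0r_neq0.
rewrite ler_pM2r ?invr_gt0//.
have : (u ^+ 2 + k%:R) / (2 * z ^+ 2) <= 1.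
  rewrite ler_pdivrMr ?mulr_gt0 ?exprn_gt0// mul1r.
  have := sqr_ge0 (3 / e); lra.
lra.
Qed.

Lemma gval_global : exists2 Y : R, 0 < Y & forall u b, Y <= sq b -> u <= al * sq b + 1 / 2 ->
  W al u b%:R - gval u b <= (9 / 4) * al / sq b ^+ 3.
Proof.
have [Y Y0 h] := vh_global Hal; exists Y => // u b hY hu.
apply/ler_addgt0Pr => e e0; have [k hk] := remainder_small u b e0.
have b0 : (0 < b)%N by move: (lt_le_trans Y0 hY); rewrite sqrtr_gt0 ltr0n.
have := h k _ _ hY hu; have := gval_ge k u b0; lra.
Qed.

Lemma sq_shift b n : (0 < b)%N -> [/\ sq b <= sq (b + n), sq (b + n) ^+ 2 = sq b ^+ 2 + n%:R &
  sq (b + n) - sq b <= n%:R / (2 * sq b)].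
Proof.
move=> b0; have y0 := @sq_gt0 R _ b0; have yz : sq b <= sq (b + n) by apply: sq_mono; rewrite leq_addr.
have e : sq (b + n) ^+ 2 = sq b ^+ 2 + n%:R by rewrite !sqE natrD.
split => //; rewrite ler_pdivlMr ?mulr_gt0//; nra.
Qed.

(** Bernoulli's inequality for [(1 + m / y ^ 2) ^ (- 3 / 2)]. *)
Lemma cube_ratio y z (m : R) : 0 < y -> y <= z -> 0 <= m -> z ^+ 2 = y ^+ 2 + m ->
  1 - 3 / 2 * m / y ^+ 2 <= (y / z) ^+ 3 <= 1.
Proof.
move=> y0 yz m0 zy; have z0 : 0 < z by apply: lt_le_trans yz.
have r1 : y / z <= 1 by rewrite ler_pdivrMr// mul1r.
have r0 : 0 <= y / z by rewrite divr_ge0 ?(ltW y0) ?(ltW z0).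
apply/andP; split; last by rewrite exprn_ile1.
have e : m / y ^+ 2 = (z / y) ^+ 2 - 1.
  by rewrite expr_div_n zy; field; exact: lt0r_neq0.
have zr : (y / z) * (z / y) = 1 by field; rewrite !lt0r_neq0.
have z1 : 1 <= z / y by rewrite ler_pdivlMr// mul1r.
rewrite -mulrA e; move: (y / z) (z / y) r1 r0 zr z1 => r s r1 r0 rs s1.
have h1 : 1 - (s ^+ 2 - 1) / 2 <= r.
  have : r * 2 <= 3 * r - r ; last nra.
  by lra.
nra.
Qed.

End value.

(** * Barriers *)

Section local_analysis.
Context {R : realType}.
Variable al : R.
Hypothesis Hal : is_alpha al.
Implicit Types (u d y t : R) (b k n x : nat).

Local Notation sq b := (Num.sqrt b%:R : R).

(** Passes from the unit [al / z ^ 3] at the current time to the fixed unit [al / y ^ 3] in which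
    both barriers are written. *)
Lemma excess_shrink d y z (m : R) : 0 < y -> y <= z -> 0 <= m -> z ^+ 2 = y ^+ 2 + m ->
  al / y ^+ 3 * (d ^+ 2 - 3 / 2 * m / y ^+ 2 * d ^+ 2) <= al * d ^+ 2 / z ^+ 3 <= al / y ^+ 3 * d ^+ 2.
Proof.
move=> y0 yz m0 zy; have z0 : 0 < z by apply: lt_le_trans yz.
have /andP[h1 h2] := cube_ratio y0 yz m0 zy.
have c0 : 0 <= al / y ^+ 3 * d ^+ 2.
  by rewrite mulr_ge0 ?sqr_ge0// divr_ge0 ?exprn_ge0 ?(ltW y0) ?(ltW (al_gt0 Hal)).
have -> : al * d ^+ 2 / z ^+ 3 = (al / y ^+ 3 * d ^+ 2) * (y / z) ^+ 3.
  by field; rewrite !lt0r_neq0.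
have -> : al / y ^+ 3 * (d ^+ 2 - 3 / 2 * m / y ^+ 2 * d ^+ 2) =
   (al / y ^+ 3 * d ^+ 2) * (1 - 3 / 2 * m / y ^+ 2) by field; exact: lt0r_neq0.
by rewrite ler_wpM2l//= ler_piMr.
Qed.

(* [x * (L - x)] is the expected time for the walk started at [x] to leave [0, L]; hence the
   barrier averages to itself along the walk exactly when [c = e]. *)
Definition barrier (L : nat) y (a g c e : R) x n : R :=
  a + g * x%:R / L%:R + c * (x%:R * (L%:R - x%:R)) / y + e * n%:R / y.

Lemma barrier_step L y a g c e x n : y != 0 -> (0 < L)%N ->
  (barrier L y a g c e x n.+1 + barrier L y a g c e x.+2 n.+1) / 2 =
  barrier L y a g c e x.+1 n - (c - e) / y.
Proof.
move=> y0 L0; have L1 : L%:R != 0 :> R by rewrite pnatr_eq0 -lt0n.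
by rewrite /barrier -!natr1; field; rewrite y0.
Qed.

(** This bounds the value from above. While the walk continues, [vh] and the barrier equal their
    averages and [W] is at least its own, so only the exits matter. At [x = 0], [sg <= 0] puts the
    start on or above the curve. At [x = L], [g = - a] makes the barrier nonpositive, and [W >= vh]
    suffices. Stopping at an interior point must be allowed for as well; there the distance to the
    curve is at least [sg + 1], hence the second condition on [a]. *)
Lemma upper_barrier (sg a : R) L b : (0 < L)%N -> 1 + 1 / al <= L%:R -> 2 <= sq b ->
  -1 <= sg -> sg <= 0 -> 0 <= a -> a <= sg ^+ 2 -> a <= (sg + 1) ^+ 2 ->
  forall k n x, (x <= L)%N ->
  al / sq b ^+ 3 * barrier L (sq b) a (- a) (- 2) (- 2) x n <=
  W al (al * sq b - sg - x%:R) (b + n)%:R - vh k (al * sq b - sg - x%:R) (b + n).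
Proof.
move=> L0 La; set y := sq b => y2 sg1 sg0 a0 as1 as2 k n x xL.
have y0 : 0 < y by lra.
have b0 : (0 < b)%N by move: y0; rewrite /y sqrtr_gt0 ltr0n.
have Lr : 0 < L%:R :> R by rewrite ltr0n.
have al0 := al_gt0 Hal; have al1 := al_lt1 Hal.
have cb0 : 0 < al / y ^+ 3 by rewrite divr_gt0// exprn_gt0.
have a1 : a <= 1 by nra.
have E0 k' n' u : 0 <= W al u (b + n')%:R - vh k' u (b + n').
  by rewrite subr_ge0; apply: vh_le_W; rewrite // ltn_addr.
have neg k' n' u (p : R) : p <= 0 ->
  al / y ^+ 3 * p <= W al u (b + n')%:R - vh k' u (b + n').
  by move=> p0; apply: le_trans (E0 _ _ _); rewrite mulr_ge0_le0// ltW.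
have xx m : (m <= L)%N -> 0 <= m%:R * (L%:R - m%:R) :> R.
  by move=> mL; rewrite mulr_ge0// subr_ge0 ler_nat.
have barE m n' : barrier L y a (- a) (- 2) (- 2) m n' =
   a * (1 - m%:R / L%:R) - 2 * (m%:R * (L%:R - m%:R)) / y - 2 * n'%:R / y.
  by rewrite /barrier; field; rewrite !lt0r_neq0.
have bar_le m n' : (m <= L)%N -> barrier L y a (- a) (- 2) (- 2) m n' <= a - 2 * n'%:R / y.
  move=> mL; rewrite barE; have : 0 <= 2 * (m%:R * (L%:R - m%:R)) / y.
    by rewrite divr_ge0 ?mulr_ge0 ?xx ?(ltW y0)// subr_ge0 ler_nat.
  have : 0 <= a * (m%:R / L%:R) by rewrite mulr_ge0 ?divr_ge0.
  lra.
have stopped m n' k' : (0 < m)%N -> (m < L)%N ->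
  vh k' (al * y - sg - m%:R) (b + n') = (al * y - sg - m%:R) / (b + n')%:R ->
  al / y ^+ 3 * barrier L y a (- a) (- 2) (- 2) m n' <=
  W al (al * y - sg - m%:R) (b + n')%:R - vh k' (al * y - sg - m%:R) (b + n').
  move=> m0 mL ->; have bn0 : (0 < b + n')%N by rewrite ltn_addr.
  have [yz zy yzn] := @sq_shift R b n' b0.
  rewrite W_sq// addrAC subrr add0r; set z := sq (b + n') in yz zy yzn *; rewrite -/y in yz zy yzn *.
  have z0 : 0 < z by apply: lt_le_trans yz.
  have m1 : 1 <= m%:R :> R by rewrite ler1n.
  have sg1' : 0 <= sg + 1 by lra.
  have mono : sg + 1 <= al * z - (al * y - sg - m%:R).
    have : al * y <= al * z by rewrite ler_pM2l.
    lra.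
  apply: le_trans (excess_mono Hal z0 sg1' mono).
  apply: le_trans (excess_ge Hal z0 sg1').
  have /andP[h1 _] := excess_shrink (sg + 1) y0 yz (ler0n _ n') zy.
  have h2 : (sg + 1) ^+ 3 / z ^+ 4 <= al / y ^+ 3 * (1 / al / y).
    have -> : al / y ^+ 3 * (1 / al / y) = 1 / y ^+ 4 by field; rewrite !lt0r_neq0.
    apply: ler_pM; rewrite ?invr_ge0 ?exprn_ge0 ?(ltW z0)//; first by apply: exprn_ile1; lra.
    by rewrite lef_pV2 ?posrE ?exprn_gt0// lerXn2r ?nnegrE ?(ltW y0) ?(ltW z0).
  apply: (@le_trans _ _ (al / y ^+ 3 *
    ((sg + 1) ^+ 2 - 3 / 2 * n'%:R / y ^+ 2 * (sg + 1) ^+ 2 - 1 / al / y))); last first.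
    by rewrite mulrBr lerB.
  rewrite ler_pM2l// barE.
  have mm : L%:R - 1 <= m%:R * (L%:R - m%:R) :> R.
    have : 1 <= L%:R - m%:R :> R by rewrite lerBrDr addrC natr1 ler_nat.
    nra.
  (* The parabola is at least [L - 1] at interior integers, which pays for the cubic error of the
     excess; this is the purpose of [1 + 1 / al <= L]. *)
  have h3 : 1 / al / y <= 2 * (m%:R * (L%:R - m%:R)) / y.
    rewrite ler_pM2r ?invr_gt0//.
    have : 0 <= 1 / al by rewrite divr_ge0// ltW.
    lra.
  have h4 : 3 / 2 * n'%:R / y ^+ 2 * (sg + 1) ^+ 2 <= 2 * n'%:R / y.
    have -> : 3 / 2 * n'%:R / y ^+ 2 * (sg + 1) ^+ 2 = (n'%:R / y) * ((3 / 2 * (sg + 1) ^+ 2) / y).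
      by field; exact: lt0r_neq0.
    have -> : 2 * n'%:R / y = (n'%:R / y) * 2 by ring.
    rewrite ler_wpM2l ?divr_ge0 ?(ltW y0)// ler_pdivrMr//.
    have : (sg + 1) ^+ 2 <= 1 by rewrite exprn_ile1//; lra.
    lra.
  have : 0 <= a * (m%:R / L%:R) by rewrite mulr_ge0 ?divr_ge0.
  lra.
have bottom n' k' :
  al / y ^+ 3 * barrier L y a (- a) (- 2) (- 2) 0 n' <=
  W al (al * y - sg - 0%:R) (b + n')%:R - vh k' (al * y - sg - 0%:R) (b + n').
  have bn0 : (0 < b + n')%N by rewrite ltn_addr.
  have [yz zy yzn] := @sq_shift R b n' b0.
  set z := sq (b + n') in yz zy yzn *; rewrite -/y in yz zy yzn *.
  have z0 : 0 < z by apply: lt_le_trans yz.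
  have [p0|p0] := leP (barrier L y a (- a) (- 2) (- 2) 0 n') 0; first exact: neg.
  rewrite subr0; set u := al * y - sg.
  have t0 : 0 <= al * z - al * y by rewrite subr_ge0 ler_pM2l.
  have t1 : al * z - al * y <= (n'%:R / y) / 2.
    have -> : n'%:R / y / 2 = n'%:R / (2 * y) by field; exact: lt0r_neq0.
    nra.
  have pE : barrier L y a (- a) (- 2) (- 2) 0 n' = a - 2 * (n'%:R / y).
    by rewrite barE; field; rewrite !lt0r_neq0.
  have f0 : 0 <= n'%:R / y by rewrite divr_ge0// ltW.
  (* Where the barrier is positive, [2 * n / y < a <= - sg], so the curve, which rises by at most
     [n / (2 * y)], has not yet reached the level of [x = 0]. *)
  have d0 : al * z - u <= 0.
    rewrite leNgt; apply/negP => d0; move: p0; rewrite pE /u in d0 *.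
    have : sg ^+ 2 <= - sg by nra.
    move: (n'%:R / y) t1 f0 d0 => f t1 f0 d0 h2 h3; suff : (1 : R) < 1 by rewrite ltxx.
    lra.
  have -> : vh k' u (b + n') = u / (b + n')%:R by apply: (vh_stop Hal) => //; rewrite -/z -subr_le0.
  rewrite W_sq// -/z addrAC subrr add0r.
  apply: le_trans (excess_ge_neg Hal z0 d0).
  have /andP[h1 _] := excess_shrink (al * z - u) y0 yz (ler0n _ n') zy.
  apply: le_trans h1; rewrite ler_pM2l// pE.
  have dE : al * z - u = sg + (al * z - al * y) by rewrite /u; ring.
  have d2 : (al * z - u) ^+ 2 <= 1 by rewrite dE in d0 *; nra.
  have d3 : a - n'%:R / y <= (al * z - u) ^+ 2.
    rewrite dE; move: (al * z - al * y) (n'%:R / y) t0 t1 => t f t0 t1; nra.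
  have -> : 3 / 2 * n'%:R / y ^+ 2 * (al * z - u) ^+ 2 = (n'%:R / y) * ((3 / 2 * (al * z - u) ^+ 2) / y).
    by field; exact: lt0r_neq0.
  have h5 : 3 / 2 * (al * z - u) ^+ 2 / y <= 1 by rewrite ler_pdivrMr//; lra.
  have := ler_wpM2l f0 h5; lra.
have top n' : barrier L y a (- a) (- 2) (- 2) L n' <= 0.
  have -> : barrier L y a (- a) (- 2) (- 2) L n' = - (2 * (n'%:R / y)).
    by rewrite barE; field; rewrite !lt0r_neq0.
  by rewrite oppr_le0 mulr_ge0// divr_ge0// ltW.
elim: k n x xL => [|k IH] n x xL.
  have [->|x0] := posnP x; first exact: bottom.
  move: xL; rewrite leq_eqVlt => /predU1P[->|xL]; last exact: stopped.
  by apply: neg; exact: top.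
have [->|x0] := posnP x; first exact: bottom.
move: xL; rewrite leq_eqVlt => /predU1P[->|xL].
  by apply: neg; exact: top.
have [le|lt] := leP ((vh k (al * y - sg - x%:R + 1) (b + n).+1 + vh k (al * y - sg - x%:R - 1) (b + n).+1) / 2)
   ((al * y - sg - x%:R) / (b + n)%:R).
  by apply: stopped => //=; rewrite max_l.
have -> : vh k.+1 (al * y - sg - x%:R) (b + n) =
  (vh k (al * y - sg - x%:R + 1) (b + n).+1 + vh k (al * y - sg - x%:R - 1) (b + n).+1) / 2.
  by rewrite /= max_r// ltW.
case: x x0 xL {lt} => // x _ xL.
have e1 : al * y - sg - x.+1%:R + 1 = al * y - sg - x%:R by rewrite -natr1; ring.
have e2 : al * y - sg - x.+1%:R - 1 = al * y - sg - x.+2%:R by rewrite -!natr1; ring.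
have := IH n.+1 x (ltnW (ltnW xL)); have := IH n.+1 x.+2 xL.
have bn0 : 0 < (b + n)%:R :> R by rewrite ltr0n ltn_addr.
have := W_super Hal (al * y - sg - x.+1%:R) bn0.
have := barrier_step a (- a) (- 2) (- 2) x n (lt0r_neq0 y0) L0.
rewrite subrr mul0r subr0 => <-; rewrite natr1 addnS e1 e2.
move: (W _ _ _) (W _ _ _) (W _ _ _) (vh _ _ _) (vh _ _ _) => w1 w2 w3 v1 v2.
move: (barrier _ _ _ _ _ _ x _) (barrier _ _ _ _ _ _ x.+2 _) (al / y ^+ 3) => B0 B2 cb.
clear; lra.
Qed.


End local_analysis.

(** * Lower barrier and local expansion of the value *)

Section local_expansion.
Context {R : realType}.
Variable al : R.
Hypothesis Hal : is_alpha al.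
Implicit Types (u d y t : R) (b k n x : nat).

Local Notation sq b := (Num.sqrt b%:R : R).

(** This bounds the value from below and uses only that [gval] dominates its average and the reward.
    The slope [9 / 4] reaches the global bound at [x = L]; [c - e = 1] leaves room for the defect of
    [W]; the time term covers the motion of the curve; [C] covers the cubic error above the
    curve. *)
Lemma lower_barrier : exists2 Y : R, 0 < Y & exists2 C : R, 0 <= C & forall b s L,
  Y <= sq b -> - 1 / 2 <= s -> s <= 1 / 2 -> (0 < L)%N ->
  forall n x, (x <= L)%N ->
  W al (al * sq b - s - x%:R) (b + n)%:R - gval (al * sq b - s - x%:R) (b + n) <=
  al / sq b ^+ 3 * barrier L (sq b) (s ^+ 2 + C / sq b) (9 / 4) 2 1 x n.
Proof.
have [Y1 Y10 glob] := gval_global Hal; have [K K0 hK] := excess_le_neg Hal.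
have al0 := al_gt0 Hal; have al1 := al_lt1 Hal.
have C0 : 0 <= K / al by rewrite divr_ge0// ltW.
exists (Y1 + 3); first lra.
exists (K / al) => // b s L; set y := sq b => yY s1 s2 L0.
have y0 : 0 < y by lra.
have b0 : (0 < b)%N by move: y0; rewrite /y sqrtr_gt0 ltr0n.
have Lr : 0 < L%:R :> R by rewrite ltr0n.
have cb0 : 0 < al / y ^+ 3 by rewrite divr_gt0// exprn_gt0.
have s20 : 0 <= s ^+ 2 by rewrite sqr_ge0.
have Cy0 : 0 <= K / al / y by rewrite divr_ge0// ltW.
have barE m n : barrier L y (s ^+ 2 + K / al / y) (9 / 4) 2 1 m n =
  s ^+ 2 + K / al / y + 9 / 4 * (m%:R / L%:R) + 2 * (m%:R * (L%:R - m%:R)) / y + n%:R / y.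
  by rewrite /barrier mul1r mulrA.
have xx m : (m <= L)%N -> 0 <= 2 * (m%:R * (L%:R - m%:R)) / y :> R.
  by move=> mL; rewrite divr_ge0 ?(ltW y0)// !mulr_ge0// subr_ge0 ler_nat.
have r0 (m : nat) : 0 <= m%:R / y :> R by rewrite divr_ge0// ltW.
have rL (m : nat) : 0 <= m%:R / L%:R :> R by rewrite divr_ge0// ltW.
have big m n : (m <= L)%N -> 9 / 4 <= barrier L y (s ^+ 2 + K / al / y) (9 / 4) 2 1 m n ->
  W al (al * y - s - m%:R) (b + n)%:R - gval (al * y - s - m%:R) (b + n) <=
  al / y ^+ 3 * barrier L y (s ^+ 2 + K / al / y) (9 / 4) 2 1 m n.
  move=> mL h; have [yz zy yzn] := @sq_shift R b n b0.
  set z := sq (b + n) in yz zy yzn *; rewrite -/y in yz zy yzn.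
  have z0 : 0 < z by apply: lt_le_trans yz.
  apply: (@le_trans _ _ (9 / 4 * al / z ^+ 3)).
    apply: glob; rewrite -/z; first lra.
    have : al * y <= al * z by rewrite ler_pM2l.
    have : 0 <= m%:R :> R by [].
    lra.
  apply: (@le_trans _ _ (al / y ^+ 3 * (9 / 4))); last by rewrite ler_pM2l.
  have -> : al / y ^+ 3 * (9 / 4) = 9 / 4 * al / y ^+ 3 by ring.
  rewrite ler_pM2l ?mulr_gt0// lef_pV2 ?posrE ?exprn_gt0// lerXn2r ?nnegrE//; exact: ltW.
have bottom n : W al (al * y - s - 0%:R) (b + n)%:R - gval (al * y - s - 0%:R) (b + n) <=
  al / y ^+ 3 * barrier L y (s ^+ 2 + K / al / y) (9 / 4) 2 1 0 n.
  have bn0 : (0 < b + n)%N by rewrite ltn_addr.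
  have [yz zy yzn] := @sq_shift R b n b0.
  set z := sq (b + n) in yz zy yzn *; rewrite -/y in yz zy yzn *.
  have z0 : 0 < z by apply: lt_le_trans yz.
  have pE : barrier L y (s ^+ 2 + K / al / y) (9 / 4) 2 1 0 n = s ^+ 2 + K / al / y + n%:R / y.
    by rewrite barE; field; rewrite !lt0r_neq0.
  have t0 : 0 <= al * z - al * y by rewrite subr_ge0 ler_pM2l.
  have t1 : al * z - al * y <= (n%:R / y) / 2.
    have -> : n%:R / y / 2 = n%:R / (2 * y) by field; exact: lt0r_neq0.
    nra.
  (* With [t] the rise of the curve, [n / y >= 2 * t]. If [s + t >= 3 / 2], then [s ^ 2 + 2 * t >= s
     ^ 2 - 2 * s + 3 >= 9 / 4] as [s <= 1 / 2], and the global bound applies. *)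
  have [big_d|small_d] := leP (3 / 2) (s + (al * z - al * y)).
    apply: big => //; rewrite pE; move: (K / al / y) Cy0 (n%:R / y) t1 => C C1 f t1.
    nra.
  rewrite pE subr0; set u := al * y - s.
  have dE : al * z - u = s + (al * z - al * y) by rewrite /u; ring.
  apply: (@le_trans _ _ (excess al (al * z - u) z)).
    by rewrite W_sq// -/z; have := vh_ge 0 u (b + n); have := gval_ge Hal 0 u bn0; lra.
  have /andP[_ h1] := excess_shrink Hal (al * z - u) y0 yz (ler0n _ n) zy.
  have [d0|d0] := leP 0 (al * z - u).
    apply: le_trans (excess_le Hal z0 d0) _; apply: le_trans h1 _.
    rewrite ler_pM2l// dE in d0 *.
    set t := al * z - al * y in t0 t1 small_d d0 *.
    (* That is, [(s + t) ^ 2 <= s ^ 2 + 2 * t], and [2 * t <= n / y]. *)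
    have h6 : 0 <= t * (2 - 2 * s - t) by rewrite mulr_ge0//; lra.
    move: (K / al / y) Cy0 (n%:R / y) t1 => C C1 f t1.
    nra.
  have z1 : 1 <= z by lra.
  have dz : - z <= al * z - u by lra.
  apply: le_trans (hK _ _ z1 dz (ltW d0)) _.
  have h2 : K * (- (al * z - u)) ^+ 3 / z ^+ 4 <= al / y ^+ 3 * (K / al / y).
    have -> : al / y ^+ 3 * (K / al / y) = K / y ^+ 4 by field; rewrite !lt0r_neq0.
    apply: ler_pM; rewrite ?invr_ge0 ?exprn_ge0 ?mulr_ge0 ?exprn_ge0 ?(ltW z0) ?oppr_ge0 ?(ltW d0)//.
      rewrite ler_piMr// exprn_ile1// ?oppr_ge0 ?(ltW d0)//; lra.
    by rewrite lef_pV2 ?posrE ?exprn_gt0// lerXn2r ?nnegrE ?(ltW y0) ?(ltW z0).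
  have h3 : (al * z - u) ^+ 2 <= s ^+ 2 by rewrite dE in d0 *; nra.
  have h4 : al / y ^+ 3 * (al * z - u) ^+ 2 <= al / y ^+ 3 * s ^+ 2 by rewrite ler_pM2l.
  have h5 : 0 <= al / y ^+ 3 * (n%:R / y) by rewrite mulr_ge0// ltW.
  rewrite !mulrDr; lra.
(* From time [N] on, the time term exceeds [3 > 9 / 4], so the global bound starts a backward
   induction on [n]. *)
pose N := Num.bound (3 * y).
have hN : 3 * y < N%:R by apply: archi_boundP; rewrite mulr_ge0// ltW.
suff main m n x : (x <= L)%N -> (N <= n + m)%N ->
  W al (al * y - s - x%:R) (b + n)%:R - gval (al * y - s - x%:R) (b + n) <=
  al / y ^+ 3 * barrier L y (s ^+ 2 + K / al / y) (9 / 4) 2 1 x n.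
  by move=> n x xL; apply: (main N) => //; rewrite leq_addl.
elim: m n x => [|m IH] n x xL Nn.
  apply: big => //; rewrite barE; have : 3 <= n%:R / y.
    by rewrite ler_pdivlMr// (le_trans (ltW hN))// ler_nat -(addn0 n).
  have := xx _ xL; have := rL x; lra.
have [->|x0] := posnP x; first exact: bottom.
move: xL; rewrite leq_eqVlt => /predU1P[->|xL].
  apply: big => //; rewrite barE divff ?lt0r_neq0//.
  have := xx _ (leqnn L); have := r0 n; lra.
case: x x0 xL => // x _ xL.
have Nm : (N <= n.+1 + m)%N by rewrite addSnnS.
have e1 : al * y - s - x.+1%:R + 1 = al * y - s - x%:R by rewrite -natr1; ring.
have e2 : al * y - s - x.+1%:R - 1 = al * y - s - x.+2%:R by rewrite -!natr1; ring.
have := IH n.+1 x (ltnW (ltnW xL)) Nm; have := IH n.+1 x.+2 xL Nm.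
have bn0 : (0 < b + n)%N by rewrite ltn_addr.
have [yz zy yzn] := @sq_shift R b n b0.
have uz : al * y - s - x.+1%:R <= al * sq (b + n).
  have : al * y <= al * sq (b + n) by rewrite ler_pM2l.
  have : 1 <= x.+1%:R :> R by rewrite ler1n.
  lra.
have := W_defect Hal (sq_gt0 bn0) uz; rewrite sqE natr1.
have := gval_super Hal (al * y - s - x.+1%:R) bn0.
have := barrier_step (s ^+ 2 + K / al / y) (9 / 4) 2 1 x n (lt0r_neq0 y0) L0.
have -> : 2 - 1 = 1 :> R by ring.
set B0 := barrier _ _ _ _ _ _ x n.+1; set B2 := barrier _ _ _ _ _ _ x.+2 n.+1.
set B1 := barrier _ _ _ _ _ _ x.+1 n => hB.
(* The barrier exceeds its average by [1 / y], and [y >= 5 / 2] makes this enough for the defect of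
   [W]. *)
have hd : 5 / 2 * al / sq (b + n) ^+ 5 <= al / y ^+ 3 * (1 / y).
  have -> : al / y ^+ 3 * (1 / y) = y * al / y ^+ 5 by field; exact: lt0r_neq0.
  apply: ler_pM; rewrite ?invr_ge0 ?exprn_ge0 ?sqrtr_ge0 ?mulr_ge0 ?(ltW al0)//.
    by rewrite ler_pM2r//; lra.
  have z0 := @sq_gt0 R _ bn0.
  by rewrite lef_pV2 ?posrE ?exprn_gt0// lerXn2r ?nnegrE ?(ltW y0) ?(ltW z0).
have -> : al / y ^+ 3 * B1 = (al / y ^+ 3 * B0 + al / y ^+ 3 * B2) / 2 + al / y ^+ 3 * (1 / y).
  by have -> : B1 = (B0 + B2) / 2 + 1 / y by [rewrite hB; ring]; ring.
rewrite !addnS e1 e2; move: hd; clear -B0 B2; clearbody B0 B2.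
move: (W _ _ _) (W _ _ _) (W _ _ _) (gval _ _) (gval _ _) (gval _ _) => w1 w2 w3 v1 v2 v3.
move: (al / y ^+ 3) (5 / 2 * al / _) => cb k; lra.
Qed.

Lemma exp_mid (x j : R) : x ^+ 2 - (x - j) ^+ 2 = 2 * j * (x - 1 / 2) - j * (j - 1).
Proof. by field. Qed.

(** Writing [b = p ^ 20] turns every exponent into a natural one: [sqrt b = p ^ 10], the strip has
    width about [q = p ^ 5], and [j <= p ^ 2]. *)
Lemma gval_expansion : exists2 p0 : R, 0 < p0 & forall (b j : nat) (p u d : R),
  p0 <= p -> p ^+ 20 = b%:R -> (0 < j)%N -> j%:R <= p ^+ 2 ->
  d = al * sq b - u -> j%:R - 1 / 2 <= d -> d <= j%:R + 1 / 2 ->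
  exists2 r : R, gval u b - u / b%:R =
    al / sq b ^+ 3 * (2 * j%:R * (d - 1 / 2) - j%:R * (j%:R - 1) + r) &
    `|r| <= 5 * j%:R / p ^+ 5.
Proof.
have [Y Y0 [C C0 low]] := lower_barrier.
have al0 := al_gt0 Hal; have al1 := al_lt1 Hal.
have i16 : 0 < 16 / al by rewrite divr_gt0.
(* [16 / al] serves the cubic term of the excess and the condition on [L] in [upper_barrier], [Y]
   and [4 * C] serve [lower_barrier], and [2] gives [j + 1 <= L]. *)
exists (16 / al + Y + 4 * C + 2); first lra.
move=> b j p u d hp pb j0 jp dE dl du.
have p2 : 2 <= p by lra.
have p0 : 0 < p by lra.
have pge m : 1 <= p ^+ m by apply: exprn_ege1; lra.
have pS m : p <= p ^+ m.+1 by rewrite exprS ler_peMr// ltW.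
have yE : sq b = p ^+ 10 by rewrite -pb (exprM p 10 2) sqrtr_sqr ger0_norm// exprn_ge0// ltW.
have yq : sq b = p ^+ 5 * p ^+ 5 by rewrite yE -exprD.
set y := sq b in dE yE yq *; set q := p ^+ 5 in yq *.
have q0 : 0 < q by rewrite exprn_gt0.
have y0 : 0 < y by rewrite yq mulr_gt0.
have qp : p <= q := pS 4.
have yp : p <= y by rewrite yE; exact: pS 9.
have b0 : (0 < b)%N by move: y0; rewrite /y sqrtr_gt0 ltr0n.
have cb0 : 0 < al / y ^+ 3 by rewrite divr_gt0// exprn_gt0.
have j1 : 1 <= j%:R :> R by rewrite ler1n.
pose L := (Num.trunc q).+1.
have Lq : q <= L%:R by rewrite ltW// /L truncnS_gt.
have qL : L%:R - 1 <= q by rewrite /L -natr1 addrK truncn_le// ltW.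
have L0 : (0 < L)%N by [].
have Lr : 0 < L%:R :> R by rewrite ltr0n.
have jL : (j.+1 <= L)%N.
  rewrite -(ler_nat R) -natr1 (le_trans _ Lq)//.
  have -> : q = p ^+ 2 * p ^+ 3 by rewrite -exprD.
  have := pge 2%N; have p3 : 2 <= p ^+ 3 by apply: le_trans p2 (pS 2).
  nra.
set w := excess al d y.
have dd : al * y - u = d by rewrite dE.
have WE : W al u b%:R = u / b%:R + w by rewrite W_sq// -/y dd.
have d0 : 0 <= d by lra.
exists ((gval u b - u / b%:R) / (al / y ^+ 3) - (2 * j%:R * (d - 1 / 2) - j%:R * (j%:R - 1))).
  by rewrite [X in _ = _ * X]addrC subrK [RHS]mulrC divfK// lt0r_neq0.
set D := gval u b - u / b%:R; rewrite -exp_mid; set s := d - j%:R.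
have s1 : - 1 / 2 <= s by rewrite /s; lra.
have s2 : s <= 1 / 2 by rewrite /s; lra.
have xq x : (0 < x)%N -> (x <= L)%N -> x%:R / L%:R <= x%:R / q :> R /\
   x%:R * (L%:R - x%:R) / y <= x%:R / q.
  move=> x0 xL; split; first by rewrite ler_wpM2l// lef_pV2 ?posrE.
  have -> : x%:R / q = x%:R * q / y by rewrite yq; field; exact: lt0r_neq0.
  rewrite ler_pM2r ?invr_gt0// ler_wpM2l//.
  have : 1 <= x%:R :> R by rewrite ler1n.
  lra.
have upper : D / (al / y ^+ 3) <= d ^+ 2 - s ^+ 2 + 5 * j%:R / q.
  have La : 1 + 1 / al <= L%:R.
    have : 1 / al <= 16 / al by rewrite ler_pM2r ?invr_gt0//; lra.
    lra.
  have y2 : 2 <= y := le_trans p2 yp.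
  (* The edge [x = 0] is placed at level [s] if this is on or above the curve ([s <= 0]), and
     otherwise one step higher, so that [sg <= 0]. Since [-1 / 2 <= s <= 1 / 2], [s ^ 2] is the
     smaller of [sg ^ 2] and [(sg + 1) ^ 2] in both cases. *)
  have up sg x : d = sg + x%:R -> (0 < x)%N -> (x <= L)%N -> (x <= j.+1)%N -> -1 <= sg -> sg <= 0 ->
     s ^+ 2 <= sg ^+ 2 -> s ^+ 2 <= (sg + 1) ^+ 2 -> D / (al / y ^+ 3) <= d ^+ 2 - s ^+ 2 + 5 * j%:R / q.
    move=> dsg x0 xL xj sg1 sg0 h1 h2.
    rewrite ler_pdivrMr//.
    have uE : u = al * y - sg - x%:R by rewrite dE in dsg; clear -dsg; lra.
    have bnd := upper_barrier Hal L0 La y2 sg1 sg0 (sqr_ge0 s) h1 h2.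
    set B := barrier L y (s ^+ 2) (- s ^+ 2) (- 2) (- 2) x 0.
    have vle : gval u b <= W al u b%:R - al / y ^+ 3 * B.
      by apply: gval_le => k; have := bnd k 0%N x xL; rewrite addn0 -uE -/B; clear; lra.
    have Bge : s ^+ 2 - 5 * j%:R / q <= B.
      have [r1 r2] := xq _ x0 xL.
      have x2 : x%:R / q <= 2 * (j%:R / q).
        rewrite mulrA ler_pM2r ?invr_gt0// -natrM ler_nat (leq_trans xj)//.
        by rewrite mul2n -addnn -addn1 leq_add2l.
      have s4 : s ^+ 2 * (x%:R / L%:R) <= (1 / 4) * (x%:R / q).
        apply: ler_pM; rewrite ?sqr_ge0 ?divr_ge0//; clear -s1 s2; nra.
      have -> : B = s ^+ 2 - s ^+ 2 * (x%:R / L%:R) - 2 * (x%:R * (L%:R - x%:R) / y).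
        by rewrite /B /barrier; field; rewrite !lt0r_neq0.
      have jq : 0 <= j%:R / q by rewrite divr_ge0// ltW.
      rewrite -(mulrA 5); clear -r2 s4 x2 jq; lra.
    have wle : w <= al / y ^+ 3 * d ^+ 2.
      have -> : al / y ^+ 3 * d ^+ 2 = al * d ^+ 2 / y ^+ 3 by ring.
      exact: excess_le.
    have : al / y ^+ 3 * (s ^+ 2 - 5 * j%:R / q) <= al / y ^+ 3 * B by rewrite ler_pM2l.
    rewrite [X in _ <= X]mulrC /D !mulrDr !mulrN; clear -wle vle WE; lra.
  have [s0|s0] := leP s 0.
    apply: (up s j) => //; rewrite ?(ltnW jL)//; [by rewrite /s; ring|clear -s1; lra|].
    by clear -s1; nra.
  apply: (up (s - 1) j.+1) => //; last by rewrite subrK.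
  - by rewrite -natr1 /s; ring.
  - by clear -s0; lra.
  - by clear -s2; lra.
  - by clear -s2; nra.
have lower : d ^+ 2 - s ^+ 2 - 5 * j%:R / q <= D / (al / y ^+ 3).
  rewrite ler_pdivlMr// mulrC.
  have yY : Y <= y by apply: le_trans yp; clear -hp i16 C0; lra.
  have := low b s L yY s1 s2 L0 0%N j (ltnW jL); rewrite addn0 -/y.
  have <- : u = al * y - s - j%:R by rewrite /s dE; ring.
  set B := barrier _ _ _ _ _ _ _ _.
  have [r1 r2] := xq _ j0 (ltnW jL).
  (* The edge and the parabola cost [9 / 4 + 2 = 17 / 4] units of [j / q]; [Cq] and [dq] cost
     [1 / 4] each, which stays below [5]. *)
  have Ble : B <= s ^+ 2 + C / y + 17 / 4 * (j%:R / q).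
    have -> : B = s ^+ 2 + C / y + 9 / 4 * (j%:R / L%:R) + 2 * (j%:R * (L%:R - j%:R) / y).
      by rewrite /B /barrier; field; rewrite !lt0r_neq0.
    lra.
  have wge : al / y ^+ 3 * (d ^+ 2 - d ^+ 3 / (al * y)) <= w.
    have -> : al / y ^+ 3 * (d ^+ 2 - d ^+ 3 / (al * y)) = al * d ^+ 2 / y ^+ 3 - d ^+ 3 / y ^+ 4.
      by field; rewrite !lt0r_neq0.
    exact: excess_ge.
  have Cq : C / y <= 1 / 4 * (j%:R / q).
    have -> : 1 / 4 * (j%:R / q) = (j%:R * q / 4) / y by rewrite yq; field; exact: lt0r_neq0.
    have C4 : 4 * C <= q by apply: le_trans qp; clear -hp i16 Y0; lra.
    rewrite ler_pM2r ?invr_gt0//; clear -C4 j1 q0; nra.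
  have dq : d ^+ 3 / (al * y) <= 1 / 4 * (j%:R / q).
    have d3 : d ^+ 3 <= 4 * j%:R ^+ 3.
      apply: (@le_trans _ _ ((3 / 2 * j%:R) ^+ 3)).
        by rewrite lerXn2r ?nnegrE//; clear -du j1 d0; lra.
      rewrite exprMn ler_wpM2r ?exprn_ge0//; clear -j1; lra.
    have j3 : j%:R ^+ 3 <= j%:R * p ^+ 4 :> R.
      rewrite exprS ler_wpM2l// (exprM p 2 2) lerXn2r ?nnegrE ?exprn_ge0//; exact: ltW.
    have p4 : 16 * p ^+ 4 <= al * q.
      have -> : al * q = (al * p) * p ^+ 4 by rewrite /q; ring.
      rewrite ler_wpM2r ?exprn_ge0 ?(ltW p0)// mulrC -ler_pdivrMr//; clear -hp Y0 C0; lra.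
    rewrite ler_pdivrMr ?mulr_gt0//.
    have -> : 1 / 4 * (j%:R / q) * (al * y) = j%:R * (al * q) / 4.
      by rewrite yq; field; exact: lt0r_neq0.
    have : j%:R * (16 * p ^+ 4) <= j%:R * (al * q) by rewrite ler_wpM2l.
    clear -d3 j3; lra.
  have -> : D = w - (W al u b%:R - gval u b) by rewrite WE /D; ring.
  have : al / y ^+ 3 * B <= al / y ^+ 3 * (s ^+ 2 + C / y + 17 / 4 * (j%:R / q)) by rewrite ler_pM2l.
  have : al / y ^+ 3 * (d ^+ 2 - s ^+ 2 - 5 * j%:R / q) <=
    al / y ^+ 3 * ((d ^+ 2 - d ^+ 3 / (al * y)) - (s ^+ 2 + C / y + 17 / 4 * (j%:R / q))).
    have jq : 0 <= j%:R / q by rewrite divr_ge0// ltW.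
    rewrite ler_pM2l// -(mulrA 5); clear -Cq dq jq; lra.
  rewrite [X in _ <= X -> _]mulrBr; clear -wge; lra.
rewrite ler_norml; apply/andP; split; clear -upper lower; lra.
Qed.


End local_expansion.

(** * Reduction of the game to the finite-horizon recursion *)

Section stopping_trees.
Context {R : realType}.
Implicit Types (u : R) (b k n : nat) (l : seq R) (z : seq R -> R).

Fixpoint tree_avg n z l : R :=
  if n is n'.+1 then (tree_avg n' z (rcons l 1) + tree_avg n' z (rcons l (-1))) / 2 else z l.

Lemma tree_avg_cons n z x l : tree_avg n z (x :: l) = tree_avg n (fun l => z (x :: l)) l.
Proof. by elim: n l => //= n IH l; rewrite -!rcons_cons !IH. Qed.

Lemma tree_avgS n z : tree_avg n.+1 z [::] =
  (tree_avg n (fun l => z (1 :: l)) [::] + tree_avg n (fun l => z (-1 :: l)) [::]) / 2.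
Proof. by rewrite /= !tree_avg_cons. Qed.

Lemma tree_avg_cst n (c : R) l : tree_avg n (fun=> c) l = c.
Proof. by elim: n l => //= n IH l; rewrite !IH; field. Qed.

(* The gain of the rule [st], which decides from the increments seen so far, forced to stop
   after [n] steps. *)
Fixpoint pay n (st : seq R -> bool) u b l : R :=
  if n is n'.+1 then
    if st [::] then u / b%:R
    else if l is x :: l' then pay n' (fun p => st (x :: p)) (u + x) b.+1 l' else u / b%:R
  else u / b%:R.

Lemma pay_le n st u b : tree_avg n (pay n st u b) [::] <= vh n u b.
Proof.
elim: n st u b => [|n IH] st u b; first by [].
have [s0|s0] := boolP (st [::]).
  have -> : pay n.+1 st u b = fun=> u / b%:R by apply/funext => l /=; rewrite s0.
  by rewrite tree_avg_cst vh_ge.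
apply: le_trans (vhS_ge n u b); rewrite tree_avgS /= (negbTE s0) ler_pM2r//.
by rewrite lerD ?IH.
Qed.

(* Testing [x == 1], rather than moving to [u + x], makes the level sets of the rule Boolean
   combinations of the events [X i = 1]. *)
Fixpoint opt_time k u b l : nat :=
  if k is k'.+1 then
    if vh k u b == u / b%:R then 0%N
    else if l is x :: l' then
      (if x == 1 then opt_time k' (u + 1) b.+1 l' else opt_time k' (u - 1) b.+1 l').+1
    else 0%N
  else 0%N.

Lemma opt_time_cons k u b x l : opt_time k.+1 u b (x :: l) =
  if vh k.+1 u b == u / b%:R then 0%N
  else (if x == 1 then opt_time k (u + 1) b.+1 l else opt_time k (u - 1) b.+1 l).+1.
Proof. by []. Qed.

Lemma opt_time_le k u b l : (opt_time k u b l <= k)%N.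
Proof.
elim: k u b l => //= k IH u b [|x l]; case: ifP => // _.
by case: ifP => _; rewrite ltnS IH.
Qed.

Definition opt_pay k u b l : R :=
  (u + \sum_(x <- take (opt_time k u b l) l) x) / (b%:R + (opt_time k u b l)%:R).

Lemma opt_pay_avg k u b : tree_avg k (opt_pay k u b) [::] = vh k u b.
Proof.
elim: k u b => [|k IH] u b.
  by rewrite /tree_avg /opt_pay big_nil addr0 addr0.
rewrite tree_avgS; have [e|e] := eqVneq (vh k.+1 u b) (u / b%:R).
  have E x : (fun l => opt_pay k.+1 u b (x :: l)) = fun=> u / b%:R.
    apply/funext => l; rewrite /opt_pay (_ : opt_time _ _ _ _ = 0%N); last first.
      by rewrite /opt_time e eqxx.
    by rewrite take0 big_nil addr0 addr0.
  by rewrite !E !tree_avg_cst e; set c := u / _; field.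
have E1 : (fun l => opt_pay k.+1 u b (1 :: l)) = opt_pay k (u + 1) b.+1.
  apply/funext => l; rewrite /opt_pay (_ : opt_time _ _ _ _ = (opt_time k (u + 1) b.+1 l).+1); last first.
    by rewrite [LHS]/= (negbTE e) eqxx.
  by rewrite /= big_cons addrA -!natrD addSnnS.
have E2 : (fun l => opt_pay k.+1 u b (-1 :: l)) = opt_pay k (u - 1) b.+1.
  apply/funext => l; rewrite /opt_pay (_ : opt_time _ _ _ _ = (opt_time k (u - 1) b.+1 l).+1); last first.
    by rewrite [LHS]/= (negbTE e) ifN// eqNr oner_eq0.
  by rewrite /= big_cons addrA -!natrD addSnnS.
rewrite E1 E2 !IH; apply/eqP; rewrite eq_le vhS_ge /=.
by move: e; rewrite [vh k.+1 _ _]/= /Num.max; case: ifP => _; rewrite ?eqxx.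
Qed.

End stopping_trees.

(** * Finite prefixes of paths *)

Section paths.
Context d (Omega : measurableType d) (R : realType) (P : probability Omega R).
Variable X : nat -> {RV P >-> R}.
Implicit Types (w : Omega) (n m i : nat) (l : seq R) (T : Omega -> option nat) (u : R).

Definition prefix n w : seq R := mkseq (fun i => X i w) n.

Lemma size_prefix n w : size (prefix n w) = n. Proof. exact: size_mkseq. Qed.

Lemma prefixP n w w' : prefix n w = prefix n w' <-> forall i, (i < n)%N -> X i w = X i w'.
Proof.
split=> [h i i_n|h].
  by rewrite -(nth_mkseq 0 (fun i => X i w) i_n) -/(prefix n w) h nth_mkseq.
by apply: (@eq_from_nth _ 0); rewrite ?size_prefix// => i i_n; rewrite !nth_mkseq// h.
Qed.

Lemma measurable_X i (B : set R) : measurable B -> measurable (X i @^-1` B).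
Proof. by move=> mB; rewrite -[_ @^-1` _]setTI; exact: (measurable_funP (X i)). Qed.

Lemma filtration_measurable n A : natural_filtration X n A -> measurable A.
Proof.
move=> h; apply: (h (@measurable _ Omega)); split; first exact: sigma_algebra_measurable.
by move=> B [i _] [C mC <-]; rewrite setTI; exact: measurable_X.
Qed.

(** The sets saturated for equality of prefixes form a sigma-algebra containing the generators. This
    turns an abstract stopping time into a rule on finite sequences. *)
Lemma filtration_prefix n A w w' : natural_filtration X n A ->
  prefix n w = prefix n w' -> A w -> A w'.
Proof.
move=> FA pw; suff: A w <-> A w' by case.
pose S : set (set Omega) := [set B | forall w w', prefix n w = prefix n w' -> (B w <-> B w')].
apply: (FA S) => //; split; last first.
  move=> _ [i /= i_n] [C mC <-] v v' /prefixP /(_ i i_n) e.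
  by rewrite /preimage/= e.
split.
- by move=> v v' _.
- by move=> B SB v v' /SB e; split=> -[_ NB]; split=> // /e.
- by move=> F SF v v' vv'; split=> -[k _ Fk]; exists k => //; move: Fk; apply (SF k _ _ vv').
Qed.

Lemma walk_prefix n w : walk X n w = \sum_(x <- prefix n w) x.
Proof.
by rewrite big_map /walk -(big_mkord xpredT (X ^~ w)) /index_iota subn0.
Qed.

Lemma measurable_walk n : measurable_fun setT (walk X n).
Proof. by apply: measurable_sum => i; exact: measurable_funP. Qed.

Lemma measurable_reward u b T : (forall n, measurable [set w | T w = Some n]) ->
  measurable_fun setT (reward X u b T).
Proof.
move=> mT _ B mB; rewrite setTI.
have -> : reward X u b T @^-1` B =
  (\bigcup_n ([set w | T w = Some n] `&`
    ((fun w => (u + walk X n w) / (b%:R + n%:R)) @^-1` B))) `|`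
  ((~` \bigcup_n [set w | T w = Some n]) `&` [set w | B 0]).
  apply/seteqP; split => w /=.
    rewrite /reward; case Tw : (T w) => [n|] Bw; first by left; exists n.
    by right; split => // -[n _ /=]; rewrite Tw.
  rewrite /reward => -[[n _ [Tw Bw]]|[Tw Bw]]; first by rewrite Tw.
  by case Tn : (T w) => [n|//]; case: Tw; exists n.
apply: measurableU.
  apply: bigcupT_measurable => n; apply: measurableI => //.
  have mf : measurable_fun setT (fun w => (u + walk X n w) / (b%:R + n%:R)).
    apply: measurable_funM => //; apply: measurable_funD => //; exact: measurable_walk.
  by rewrite -[_ @^-1` _]setTI; exact: mf.
apply: measurableI; first by apply: measurableC; exact: bigcupT_measurable.
by have [b0|b0] := pselect (B 0); [rewrite (_ : [set _ | _] = setT)|rewrite (_ : [set _ | _] = set0)];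
  rewrite //; apply/seteqP; split.
Qed.

End paths.

(** * The law of finite paths *)

Section law_of_paths.
Context d (Omega : measurableType d) (R : realType) (P : probability Omega R).
Variable X : nat -> {RV P >-> R}.
Hypothesis HX : iid_signs X.
Implicit Types (w : Omega) (n m i : nat) (l : seq R) (T : Omega -> option nat) (u : R).

Definition cylinder l := [set w | prefix X (size l) w = l].

Definition signs l := all (mem [:: 1; -1]) l.

Lemma cylinderE l : cylinder l =
  \bigcap_(i in [set` [fset i in iota 0 (size l)]%fset]) (X i @^-1` [set nth 0 l i]).
Proof.
apply/seteqP; split => w /=.
  move=> h i /=; rewrite !inE/= mem_iota add0n => /= il.
  by rewrite /preimage/= -h nth_mkseq.
move=> h; apply: (@eq_from_nth _ 0); rewrite ?size_prefix// => i il.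
by rewrite nth_mkseq//; apply: h; rewrite /= !inE/= mem_iota.
Qed.

Lemma measurable_cylinder l : measurable (cylinder l).
Proof.
rewrite cylinderE bigcap_fset; apply: bigsetI_measurable => i _.
by apply: measurable_X; exact: measurable_set1.
Qed.

Lemma cylinder_prob l : signs l -> P (cylinder l) = (2 ^- size l)%:E.
Proof.
move=> sl; rewrite cylinderE; have [ind half] := HX.
rewrite (ind _ (fun i => [set nth 0 l i])) //.
transitivity (\prod_(i <- [fset i in iota 0 (size l)]%fset) (2^-1 : R)%:E)%E.
  apply: eq_big_seq => i; rewrite !inE/= mem_iota add0n => /= il.
  have [h1 h2] := half i; have /allP/(_ _ (mem_nth 0 il)) := sl.
  by rewrite !inE => /orP[] /eqP ->.
by rewrite prodEFin big_const_seq count_predT card_fseq undup_id ?iota_uniq// size_iota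
  iter_mulr_1 exprVn.
Qed.

Lemma signs_rcons l (x : R) : signs l -> x \in [:: 1; -1] -> signs (rcons l x).
Proof. by rewrite /signs all_rcons => sl xs; apply/andP; split. Qed.

Lemma cylinder_rcons l (x : R) : cylinder (rcons l x) `<=` cylinder l.
Proof.
move=> w; rewrite /cylinder/= size_rcons /prefix mkseqS => /eqP.
by rewrite eqseq_rcons => /andP[/eqP].
Qed.

Lemma sign_neq : (1 : R) != -1.
Proof. by rewrite eq_sym eqNr oner_eq0. Qed.

Lemma cylinder_disj l : cylinder (rcons l 1) `&` cylinder (rcons l (-1)) = set0.
Proof.
rewrite -subset0 => w [] /=; rewrite /cylinder/= !size_rcons => -> /eqP.
by rewrite eqseq_rcons eqxx/= (negbTE sign_neq).
Qed.

(** [Z] is prescribed on sign paths only. Each split of a cylinder into its two sign extensions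
    leaves out a set of probability zero, since the two halves already have full mass. *)
Lemma integral_cylinder (Z : Omega -> R) (z : seq R -> R) n l : signs l ->
  measurable_fun setT Z ->
  (forall w, signs (prefix X (size l + n) w) -> Z w = z (prefix X (size l + n) w)) ->
  (\int[P]_(w in cylinder l) (Z w)%:E = (tree_avg n z l * 2 ^- size l)%:E)%E.
Proof.
move=> sl mZ; elim: n l sl => [|n IH] l sl Zz.
  transitivity (\int[P]_(w in cylinder l) (z l)%:E)%E.
    apply: eq_integral => w; rewrite inE => wl; congr (_%:E).
    by move: Zz; rewrite addn0 => /(_ w); rewrite wl; exact.
  rewrite integral_cst; last exact: measurable_cylinder.
  by rewrite [X in (_ * X)%E](cylinder_prob sl) -EFinM.
set A1 := cylinder (rcons l 1); set A2 := cylinder (rcons l (-1)).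
have s1 : signs (rcons l 1) by apply: signs_rcons; rewrite ?inE ?eqxx.
have s2 : signs (rcons l (-1)) by apply: signs_rcons; rewrite ?inE ?eqxx ?orbT.
have m1 : measurable A1 by exact: measurable_cylinder.
have m2 : measurable A2 by exact: measurable_cylinder.
have ml : measurable (cylinder l) by exact: measurable_cylinder.
have mU : measurable (A1 `|` A2) by exact: measurableU.
have mN : measurable (cylinder l `\` (A1 `|` A2)) by exact: measurableD.
have sub : A1 `|` A2 `<=` cylinder l by move=> w [] /cylinder_rcons.
have disj : [disjoint A1 & A2] by apply/disj_set2P; exact: cylinder_disj.
have PU : P (A1 `|` A2) = P (cylinder l).
  have e : (P A1 + P A2 = P (cylinder l))%E.
    rewrite (cylinder_prob s1) (cylinder_prob s2) (cylinder_prob sl) !size_rcons -EFinD exprS.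
    by congr (_%:E); field; rewrite expf_neq0.
  by rewrite measureU//; exact: cylinder_disj.
have PN : P (cylinder l `\` (A1 `|` A2)) = 0%E.
  have e : (P (cylinder l) - P (A1 `|` A2) = 0)%E by rewrite PU (cylinder_prob sl) subee.
  rewrite measureD//; last by rewrite (le_lt_trans (probability_le1 P ml))// ltry.
  by rewrite setIidr.
have mE D : measurable_fun D (EFin \o Z).
  by apply/measurable_EFinP; exact: measurable_funTS.
have disjN : [disjoint A1 `|` A2 & cylinder l `\` (A1 `|` A2)].
  by apply/disj_set2P; rewrite setDE setICA setICr setI0.
have e := integral_setU P mU mN (mE _) disjN.
rewrite (setDUK sub) (null_set_integral mN (mE _) PN) adde0 in e.
rewrite e (integral_setU P m1 m2 (mE _) disj).
rewrite !IH//; try by rewrite size_rcons addSnnS.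
by rewrite -EFinD !size_rcons /= exprS; congr (_%:E); field; rewrite expf_neq0.
Qed.

Lemma expectation_path (Z : Omega -> R) (z : seq R -> R) n : measurable_fun setT Z ->
  (forall w, signs (prefix X n w) -> Z w = z (prefix X n w)) ->
  ('E_P[Z] = (tree_avg n z [::])%:E)%E.
Proof.
move=> mZ h; have := @integral_cylinder Z z n [::] isT mZ h.
have -> : cylinder [::] = setT by apply/seteqP; split.
by rewrite expr0 invr1 mulr1 unlock.
Qed.

End law_of_paths.

(** * The game value is the limit of the finite-horizon values *)

Section value_of_game.
Context d (Omega : measurableType d) (R : realType) (P : probability Omega R).
Variable X : nat -> {RV P >-> R}.
Hypothesis HX : iid_signs X.
Implicit Types (w : Omega) (n m i : nat) (l : seq R) (T : Omega -> option nat) (u : R).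

Definition opt_rule k u b w : option nat := Some (opt_time k u b (prefix X k w)).

(** The list read by the rule may extend beyond time [n], but the event involves only the steps [i],
    ..., [i + m - 1]. The offset [i] is what the induction needs, each step of the recursion testing
    [X i = 1] and moving to [i.+1]. *)
Lemma opt_time_filtration n k i m u b : (i + m <= n)%N ->
  natural_filtration X n [set w | opt_time k u b (mkseq (fun j => X (i + j) w) k) = m].
Proof.
pose F := \bigcup_(i in `I_n) preimage_set_system setT (X i) measurable.
have FC A : natural_filtration X n A -> natural_filtration X n (~` A) := @sigma_algebraC _ F A.
have FI A B : natural_filtration X n A -> natural_filtration X n B ->
    natural_filtration X n (A `&` B) := @measurableI _ (g_sigma_algebraType F) A B.
have FU A B : natural_filtration X n A -> natural_filtration X n B ->
    natural_filtration X n (A `|` B) := @measurableU _ (g_sigma_algebraType F) A B.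
have F0 : natural_filtration X n set0 := @measurable0 _ (g_sigma_algebraType F).
have FT : natural_filtration X n setT := @measurableT _ (g_sigma_algebraType F).
have Fb (Q : Prop) : natural_filtration X n [set _ | Q].
  have [q|q] := pselect Q.
    by rewrite (_ : [set _ | _] = setT)//; apply/seteqP; split.
  by rewrite (_ : [set _ | _] = set0)//; apply/seteqP; split.
elim: k i m u b => [|k IH] i m u b imn.
  by rewrite /=; exact: (Fb (0%N = m)).
have shift w : mkseq (fun j => X (i + j) w) k.+1 =
    X i w :: mkseq (fun j => X (i.+1 + j) w) k.
  rewrite /mkseq /= addn0 (iotaDl 1 0) -map_comp; congr (_ :: _).
  by apply: eq_map => j /=; rewrite add1n addSnnS.
have [e|e] := boolP (vh k.+1 u b == u / b%:R).
  rewrite (_ : [set _ | _] = [set _ | 0%N = m]); first exact: Fb.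
  by apply/seteqP; split => w; rewrite /mkset shift opt_time_cons e.
case: m imn => [|m] imn.
  rewrite (_ : [set _ | _] = set0)//; apply/seteqP; split => w //.
  by rewrite /mkset shift opt_time_cons (negbTE e).
have FX : natural_filtration X n (X i @^-1` [set 1]).
  apply: sub_sigma_algebra; exists i => /=.
    by rewrite (leq_trans _ imn)// addnS ltnS leq_addr.
  by exists [set 1]; [exact: measurable_set1|rewrite setTI].
have imn' : (i.+1 + m <= n)%N by rewrite addSnnS.
rewrite (_ : [set _ | _] =
  (X i @^-1` [set 1] `&` [set w | opt_time k (u + 1) b.+1 (mkseq (fun j => X (i.+1 + j) w) k) = m]) `|`
  ((~` (X i @^-1` [set 1])) `&` [set w | opt_time k (u - 1) b.+1 (mkseq (fun j => X (i.+1 + j) w) k) = m])).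
  exact: (FU _ _ (FI _ _ FX (IH _ _ _ _ imn')) (FI _ _ (FC _ FX) (IH _ _ _ _ imn'))).
apply/seteqP; split => w; rewrite /mkset /setU /setI /setC /mkset shift opt_time_cons (negbTE e).
  by have [x1|x1] := eqVneq (X i w) 1 => -[h]; [left|right; split => //; exact/eqP].
by move=> [[h <-]|[h <-]]; [rewrite (h : X i w = 1) eqxx|rewrite (introF eqP (h : X i w <> 1))].
Qed.

Lemma opt_rule_stopping k u b : stopping_time X (opt_rule k u b).
Proof.
move=> n; have := @opt_time_filtration n k 0 n u b (leqnn n).
congr (natural_filtration _ _ _); apply/seteqP; split => w; rewrite /mkset /opt_rule /prefix.
  by move=> ->.
by case.
Qed.

Lemma opt_rule_value k u b : ('E_P[reward X u b (opt_rule k u b)] = (vh k u b)%:E)%E.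
Proof.
rewrite -opt_pay_avg; apply: (expectation_path HX).
  apply: measurable_reward => n; apply: filtration_measurable; exact: opt_rule_stopping.
move=> w _; rewrite /reward /opt_pay /=; congr ((_ + _) / _).
by rewrite walk_prefix /prefix /mkseq -map_take take_iota (minn_idPl (opt_time_le _ _ _ _)).
Qed.

Lemma vh_le_V k u b : ((vh k u b)%:E <= V X u b)%E.
Proof.
apply: ereal_sup_ubound; exists (opt_rule k u b); last exact: opt_rule_value.
by split; [exact: opt_rule_stopping|apply: aeW => w].
Qed.

Definition truncate n T w : option nat :=
  if T w is Some m then Some (minn m n) else Some n.

Section fixed_rule.
Variables (u : R) (b : nat) (T : Omega -> option nat).
Hypothesis ST : stopping_time X T.

(** The existential quantifier chooses one path with prefix [l]; by [filtration_prefix] the answer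
    is the same for all of them. *)
Definition stops l : bool := `[< exists w, prefix X (size l) w = l /\ T w = Some (size l) >].

Lemma stopsP i w : stops (prefix X i w) = (T w == Some i).
Proof.
apply/asboolP/eqP; rewrite size_prefix; last by exists w.
have F : natural_filtration X i [set w | T w = Some i] := @ST i.
by move=> [w' [pw Tw']]; exact: (filtration_prefix F pw Tw').
Qed.

Lemma prefixS i w : prefix X i.+1 w = rcons (prefix X i w) (X i w).
Proof. exact: mkseqS. Qed.

(** Stated from an arbitrary time [i] not preceded by [T], so that the recursion of [pay] can
    advance; it is used at [i = 0]. *)
Lemma pay_truncate n i w : (forall m, (m < i)%N -> T w <> Some m) ->
  pay n (fun p => stops (prefix X i w ++ p)) (u + walk X i w) (b + i)
    (mkseq (fun j => X (i + j) w) n) = reward X u b (truncate (i + n) T) w.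
Proof.
elim: n i => [|n IH] i hi.
  rewrite /= addn0 /reward /truncate natrD; case Tw : (T w) => [m|//].
  suff -> : minn m i = i by [].
  by apply/minn_idPr; rewrite leqNgt; apply/negP => /hi; rewrite Tw.
rewrite [LHS]/= cats0 stopsP; case: eqP => [Tw|Tw].
  by rewrite /reward /truncate Tw natrD (minn_idPl _)// leq_addr.
rewrite /mkseq /= addn0 (iotaDl 1 0) -map_comp.
have -> : (fun p => stops (prefix X i w ++ X i w :: p)) = (fun p => stops (prefix X i.+1 w ++ p)).
  by apply/funext => p; rewrite prefixS cat_rcons.
have -> : u + walk X i w + X i w = u + walk X i.+1 w by rewrite /walk big_ord_recr/= addrA.
rewrite -[(i + n.+1)%N]addSnnS -IH.
  by rewrite addnS; congr pay; apply: eq_map => j /=; rewrite add1n addSnnS.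
by move=> m; rewrite ltnS leq_eqVlt => /predU1P[->//|/hi].
Qed.

Lemma measurable_stop m : measurable [set w | T w = Some m].
Proof. exact: filtration_measurable (@ST m). Qed.

Lemma measurable_truncate n m : measurable [set w | truncate n T w = Some m].
Proof.
have [mn|nm|->] := ltngtP m n.
- rewrite (_ : [set _ | _] = [set w | T w = Some m]); first exact: measurable_stop.
  apply/seteqP; split => w; rewrite /mkset /truncate; case: (T w) => [p|//] [e].
    by move: e mn; rewrite /minn; case: ltnP => [_ ->//|_ ->]; rewrite ltnn.
  + by rewrite e ltnn in mn.
  + by rewrite e (minn_idPl (ltnW mn)).
- rewrite (_ : [set _ | _] = set0)//; apply/seteqP; split => w //.
  rewrite /mkset /truncate; case: (T w) => [p|] [e]; move: nm; rewrite -e ?ltnn//.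
  by rewrite ltnNge geq_minr.
- rewrite (_ : [set _ | _] = ~` \bigcup_(m in `I_n) [set w | T w = Some m]).
    by apply: measurableC; apply: bigcup_measurable => p _; exact: measurable_stop.
  apply/seteqP; split => w; rewrite /mkset /truncate.
    move=> + [p /= pn Tp]; rewrite Tp => -[e].
    by move/minn_idPr: e; rewrite leqNgt pn.
  case Tw : (T w) => [p|//] h; congr Some; apply/minn_idPr; rewrite leqNgt; apply/negP => pn.
  by apply: h; exists p.
Qed.

Lemma truncate_value n : ('E_P[reward X u b (truncate n T)] <= (vh n u b)%:E)%E.
Proof.
rewrite (@expectation_path _ _ _ _ _ HX _ (pay n stops u b) n).
- by rewrite lee_fin pay_le.
- by apply: measurable_reward => m; exact: measurable_truncate.
move=> w _; have h : forall m, (m < 0)%N -> T w <> Some m by [].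
have := pay_truncate n h; rewrite add0n addn0 /walk big_ord0 addr0 => <-.
by [].
Qed.

End fixed_rule.

Lemma steps_bounded : {ae P, forall w, forall i, `|X i w| <= 1}.
Proof.
apply/ae_foralln => i; have [_ /(_ i) [h1 h2]] := HX.
have m1 : measurable (X i @^-1` [set 1]) by apply: measurable_X; exact: measurable_set1.
have m2 : measurable (X i @^-1` [set -1]) by apply: measurable_X; exact: measurable_set1.
exists (~` (X i @^-1` [set 1] `|` X i @^-1` [set -1])); split.
- by apply: measurableC; exact: measurableU.
- have e : (P (X i @^-1` [set 1%R]) + P (X i @^-1` [set (-1)%R]) = 1)%E.
    by rewrite h1 h2 -EFinD; congr (_%:E); field.
  have PU : P (X i @^-1` [set 1%R] `|` X i @^-1` [set (-1)%R]) = 1%E.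
    rewrite measureU//; rewrite -subset0 => w [] /=; rewrite /preimage/= => -> /eqP.
    by rewrite (negbTE (sign_neq R)).
  by have := probability_setC P (measurableU _ _ m1 m2); rewrite PU subee.
- by move=> w; apply: contra_not => /= -[] ->; rewrite ?normrN normr1.
Qed.

Lemma reward_bounded u b T : (0 < b)%N ->
  {ae P, forall w, `|reward X u b T w| <= `|u| + 1}.
Proof.
move=> b0; apply: filterS steps_bounded => w h; rewrite /reward; case: (T w) => [n|]; last first.
  by rewrite normr0 addr_ge0.
have bn : 0 < b%:R + n%:R :> R by rewrite ltr_wpDr// ltr0n.
rewrite normrM normfV (ger0_norm (ltW bn)) ler_pdivrMr//.
apply: (@le_trans _ _ (`|u| + n%:R)).
  rewrite (le_trans (ler_normD _ _))// lerD2l (le_trans (ler_norm_sum _ _ _))//.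
  rewrite (@le_trans _ _ (\sum_(i < n) 1))//; first by apply: ler_sum => i _.
  by rewrite sumr_const card_ord.
have b1 : 1 <= b%:R :> R by rewrite ler1n.
have n0 : 0 <= n%:R :> R by [].
have := normr_ge0 u; nra.
Qed.

(** The truncations of [T] are handled by [pay_le]. Their rewards are eventually equal to that of
    [T] almost surely, and bounded by [|u| + 1] because [n] steps move the walk by at most [n];
    dominated convergence concludes. *)
Lemma expectation_le u b T (c : R) : (0 < b)%N -> stopping_time X T -> as_finite P T ->
  (forall n, vh n u b <= c) -> ('E_P[reward X u b T] <= c%:E)%E.
Proof.
move=> b0 ST FT hc; rewrite unlock.
have mT : measurable_fun setT (EFin \o reward X u b T).
  by apply/measurable_EFinP; apply: measurable_reward => n; exact: measurable_stop.
have mTn n : measurable_fun setT (EFin \o reward X u b (truncate n T)).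
  by apply/measurable_EFinP; apply: measurable_reward => m; exact: measurable_truncate.
have cv : {ae P, forall w, setT w ->
    (EFin \o reward X u b (truncate n T)) w @[n --> \oo] --> (EFin \o reward X u b T) w}.
  apply: filterS FT => w Tw _; case Tm : (T w) => [m|//].
  apply: cvg_near_cst; exists m => // n /= mn.
  by rewrite /reward /truncate Tm (minn_idPl mn).
have ig : P.-integrable setT (fun=> (`|u| + 1)%:E) by exact: finite_measure_integrable_cst.
have dom : {ae P, forall w n, setT w ->
    (`|(EFin \o reward X u b (truncate n T)) w| <= (`|u| + 1)%:E)%E}.
  apply: filterS (ae_foralln (fun n => reward_bounded u (truncate n T) b0)) => w h n _.
  by rewrite /= lee_fin; exact: h.
have [_ _ lim] := dominated_convergence measurableT mTn mT cv ig dom.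
apply: cvge_le lim; apply: nearW => n.
have := truncate_value u b ST n; rewrite unlock => /le_trans; apply.
by rewrite lee_fin hc.
Qed.



(** The bound [c] ensures that [gval] is a true supremum and not the default value of [sup]. *)
Lemma V_gval (c : R) u b : (0 < b)%N -> (forall n, vh n u b <= c) -> V X u b = (gval u b)%:E.
Proof.
move=> b0 hc; have ub n : vh n u b <= gval u b.
  by apply: ub_le_sup; [exists c => _ [n' _ <-]|exists n].
have le : (V X u b <= (gval u b)%:E)%E.
  by apply: ge_ereal_sup => _ [T [ST FT] <-]; exact: expectation_le b0 ST FT ub.
apply/eqP; rewrite eq_le le/=; have : forall k, ((vh k u b)%:E <= V X u b)%E by move=> k; exact: vh_le_V.
case: (V X u b) le => [r| |] // _ h; last by have := h 0%N; rewrite leNgt ltNyr.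
rewrite lee_fin; apply: ge_sup; first by exists (vh 0 u b); exists 0%N.
by move=> _ [k _ <-]; rewrite -lee_fin.
Qed.

End value_of_game.

(** * The constants [M j] and the conclusion *)

Lemma M_step j : M j.+2 = (M j.+1 + (4 * j.+1 ^ 2 + 7 * j.+1 + 11))%N.
Proof. by rewrite !addnA. Qed.

Lemma M_upper j : (0 < j)%N -> (M j <= 5 * j ^ 3)%N.
Proof.
case: j => // j _; elim: j => // j IH; rewrite M_step.
have -> : (5 * j.+2 ^ 3 = 5 * j.+1 ^ 3 + (4 * j.+1 ^ 2 + 7 * j.+1 + 11) + (11 * j ^ 2 + 30 * j + 13))%N.
  by ring.
by rewrite (leq_trans _ (leq_addr _ _))// leq_add2r.
Qed.

(** [5 * j] is the error constant of [gval_expansion]; each increment of [M] is at least [11]. *)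
Lemma M_lower j : (0 < j)%N -> (5 * j <= M j)%N.
Proof.
case: j => // j _; elim: j => // j IH; rewrite M_step.
have -> : (5 * j.+2 = 5 * j.+1 + 5)%N by ring.
by rewrite leq_add// (leq_trans _ (leq_addl _ _)).
Qed.

Theorem theorem6p2 (R : realType) (alpha : R) (Halpha : is_alpha alpha) :
  (forall j : nat, (1 <= j)%N -> (M j <= 5 * j ^ 3)%N) /\
  exists b0 : nat,
    forall (d : measure_display) (Omega : measurableType d)
      (P : probability Omega R) (X : nat -> {RV P >-> R}),
      iid_signs X ->
      forall (b j : nat) (u delta : R),
        (b0 <= b)%N ->
        (1 <= j)%N -> j%:R <= b%:R `^ (1 / 10) :> R ->
        delta = alpha * Num.sqrt b%:R - u ->
        j%:R - 1 / 2 <= delta <= j%:R + 1 / 2 ->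
        exists r : R,
          (V X u b - (u / b%:R)%:E =
           (alpha / b%:R `^ (3 / 2) *
            (2 * j%:R * (delta - 1 / 2) - j%:R * (j%:R - 1) + r))%:E)%E /\
          `|r| <= (M j)%:R * b%:R `^ (- (1 / 4)).
Proof.
split; first exact: M_upper.
have [p0 p0_gt0 expansion] := gval_expansion Halpha.
exists (Num.bound (p0 ^+ 20)) => d Omega P X HX b j u delta b0 j1 jb dE /andP[dl du].
have b_gt : p0 ^+ 20 < b%:R.
  apply: lt_le_trans (archi_boundP _) _; first by rewrite exprn_ge0// ltW.
  by rewrite ler_nat.
have b_gt0 : 0 < b%:R :> R by rewrite (lt_trans _ b_gt)// exprn_gt0.
pose p : R := b%:R `^ (1 / 20).
have p_ge0 : 0 <= p by exact: powR_ge0.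
have pE k : b%:R `^ (k%:R / 20) = p ^+ k :> R.
  by rewrite -powR_mulrn// /p -powRrM; congr (_ `^ _); ring.
have pb : p ^+ 20 = b%:R by rewrite -pE divff// powRr1// ltW.
have hp : p0 <= p.
  by rewrite -(@ler_pXn2r _ 20)// ?nnegrE ?(ltW p0_gt0)// pb ltW.
have e10 : b%:R `^ (1 / 10) = p ^+ 2 :> R by rewrite -pE; congr (_ `^ _); field.
have e4 : b%:R `^ (- (1 / 4)) = p ^- 5 :> R.
  by rewrite powRN -pE; congr ((_ `^ _)^-1); field.
have e32 : b%:R `^ (3 / 2) = Num.sqrt b%:R ^+ 3 :> R.
  have -> : Num.sqrt b%:R = p ^+ 10 :> R.
    by rewrite -pb (exprM p 10 2) sqrtr_sqr ger0_norm// exprn_ge0.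
  by rewrite -exprM -pE; congr (_ `^ _); field.
have b1 : (0 < b)%N by rewrite -(ltr0n R).
rewrite e10 in jb.
have [r rE rle] := expansion b j p u delta hp pb j1 jb dE dl du.
exists r; rewrite e4 e32; split.
  rewrite (V_gval HX b1 (fun k => vh_le_W Halpha k u b1)) -EFinB rE.
  by congr (_ * (_ + _))%:E.
apply: le_trans rle _; rewrite ler_wpM2r ?invr_ge0 ?exprn_ge0//.
by rewrite -natrM ler_nat M_lower.
Qed.
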